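(* Let $(S,\mathfrak n)$ be a commutative noetherian local ring and let $\omega\in\mathfrak n$ be a non-zerodivisor. Then $\mathsf{Mon}(\omega,\mathcal P)$ is a Frobenius subcategory of the Frobenius category $\mathsf{Mon}(\omega,\mathcal G)$. In particular, $\mathsf{Mon}(\omega,\mathcal P)$ and $\mathsf{Mon}(\omega,\mathcal G)$ have the same projective objects.
   Context: All modules are finitely generated. $\mathcal P(S)$ (resp. $\mathcal G(S)$) denotes the category of finitely generated projective (resp. Gorenstein projective) $S$-modules. $\mathsf{Mor}(S)$ is the abelian category whose objects are $S$-homomorphisms $(M\xrightarrow{f}N)$ of finitely generated $S$-modules, a morphism $(M\xrightarrow{f}N)\to(M'\xrightarrow{f'}N')$ being a pair $(\psi_1,\psi_0)$ of $S$-homomorphisms $\psi_1:M\to M'$, $\psi_0:N\to N'$ with $\psi_0f=f'\psi_1$. $\mathsf{Mon}(\omega,\mathcal G)$ is the full subcategory of $\mathsf{Mor}(S)$ whose objects are the monomorphisms $(G\xrightarrow{f}P)$ with $G\in\mathcal G(S)$, $P\in\mathcal P(S)$ and $\omega\cdot\operatorname{Coker}f=0$; $\mathsf{Mon}(\omega,\mathcal P)$ is the full subcategory of those objects $(P\xrightarrow{f}Q)$ with $P,Q\in\mathcal P(S)$. The exact structure on each of the two categories has as conflations the short exact sequences of $\mathsf{Mor}(S)$ (i.e. componentwise exact) all of whose terms lie in the category. An exact category is called Frobenius if it has enough projectives and enough injectives (relative to the conflations) and the projective objects coincide with the injective objects. *)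

(* Defs.v *)
From HB Require Import structures.
From mathcomp Require Import all_boot all_algebra.
From mathcomp Require Import boolp.

Set Implicit Arguments.
Unset Strict Implicit.
Unset Printing Implicit Defensive.

Import GRing.Theory.
Local Open Scope ring_scope.

Reserved Notation "g \oc f" (at level 40, left associativity).

Record preadditive := Preadditive {
  obj :> Type;
  arr : obj -> obj -> zmodType;
  id_arr : forall X, arr X X;
  comp_arr : forall X Y Z, arr Y Z -> arr X Y -> arr X Z
    where "g \oc f" := (comp_arr g f);
  comp_arrA : forall X Y Z T (h : arr Z T) (g : arr Y Z) (f : arr X Y),
    h \oc (g \oc f) = (h \oc g) \oc f;
  comp_arrf1 : forall X Y (f : arr X Y), f \oc id_arr X = f;
  comp_arr1f : forall X Y (f : arr X Y), id_arr Y \oc f = f;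
  comp_arrDl : forall X Y Z (g g' : arr Y Z) (f : arr X Y),
    (g + g') \oc f = g \oc f + g' \oc f;
  comp_arrDr : forall X Y Z (g : arr Y Z) (f f' : arr X Y),
    g \oc (f + f') = g \oc f + g \oc f'
}.

Arguments arr {p} X Y.
Arguments id_arr {p} X.
Arguments comp_arr {p X Y Z} g f.
Notation "g \oc f" := (comp_arr g f).

Definition full_sub (C : preadditive) (D : C -> Prop) : preadditive :=
  @Preadditive {X : C | D X}
    (fun X Y => arr (sval X) (sval Y))
    (fun X => id_arr (sval X))
    (fun X Y Z g f => g \oc f)
    (fun X Y Z T => @comp_arrA C (sval X) (sval Y) (sval Z) (sval T))
    (fun X Y => @comp_arrf1 C (sval X) (sval Y))
    (fun X Y => @comp_arr1f C (sval X) (sval Y))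
    (fun X Y Z => @comp_arrDl C (sval X) (sval Y) (sval Z))
    (fun X Y Z => @comp_arrDr C (sval X) (sval Y) (sval Z)).

Section ExactCategories.

Variable C : preadditive.

Definition is_zero_object (X : C) : Prop := id_arr X = 0.

Definition is_biproduct (X Y B : C) (i1 : arr X B) (i2 : arr Y B)
    (p1 : arr B X) (p2 : arr B Y) : Prop :=
  [/\ p1 \oc i1 = id_arr X, p2 \oc i2 = id_arr Y, p2 \oc i1 = 0, p1 \oc i2 = 0
    & i1 \oc p1 + i2 \oc p2 = id_arr B].

Definition is_additive : Prop :=
  (exists X, is_zero_object X) /\
  (forall X Y, exists B i1 i2 p1 p2, @is_biproduct X Y B i1 i2 p1 p2).

Definition is_iso (X Y : C) (f : arr X Y) : Prop :=
  exists g : arr Y X, g \oc f = id_arr X /\ f \oc g = id_arr Y.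

Definition is_kernel (X Y Z : C) (i : arr X Y) (p : arr Y Z) : Prop :=
  p \oc i = 0 /\
  forall T (t : arr T Y), p \oc t = 0 -> exists! u : arr T X, i \oc u = t.

Definition is_cokernel (X Y Z : C) (i : arr X Y) (p : arr Y Z) : Prop :=
  p \oc i = 0 /\
  forall T (t : arr Y T), t \oc i = 0 -> exists! u : arr Z T, u \oc p = t.

Definition is_pushout (X Y X' Y' : C) (i : arr X Y) (f : arr X X')
    (i' : arr X' Y') (f' : arr Y Y') : Prop :=
  f' \oc i = i' \oc f /\
  forall T (s : arr Y T) (t : arr X' T), s \oc i = t \oc f ->
    exists! u : arr Y' T, u \oc f' = s /\ u \oc i' = t.

Definition is_pullback (Y Z Y' Z' : C) (p : arr Y Z) (f : arr Z' Z)
    (p' : arr Y' Z') (f' : arr Y' Y) : Prop :=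
  p \oc f' = f \oc p' /\
  forall T (s : arr T Y) (t : arr T Z'), p \oc s = f \oc t ->
    exists! u : arr T Y', f' \oc u = s /\ p' \oc u = t.

Definition pair_class := forall X Y Z : C, arr X Y -> arr Y Z -> Prop.

Variable E : pair_class.

Definition inflation (X Y : C) (i : arr X Y) : Prop :=
  exists Z (p : arr Y Z), E i p.

Definition deflation (Y Z : C) (p : arr Y Z) : Prop :=
  exists X (i : arr X Y), E i p.

Definition iso_closed : Prop :=
  forall X Y Z (i : arr X Y) (p : arr Y Z)
         X' Y' Z' (i' : arr X' Y') (p' : arr Y' Z')
         (a : arr X X') (b : arr Y Y') (c : arr Z Z'),
    is_iso a -> is_iso b -> is_iso c ->
    b \oc i = i' \oc a -> c \oc p = p' \oc b -> E i p -> E i' p'.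

(* Quillen's axioms, in the self-dual form of Keller and Bühler. *)
Record exact_category : Prop := ExactCategory {
  exact_additive : is_additive;
  exact_kercoker : forall X Y Z (i : arr X Y) (p : arr Y Z),
    E i p -> is_kernel i p /\ is_cokernel i p;
  exact_iso_closed : iso_closed;
  exact_inflation_id : forall X, inflation (id_arr X);
  exact_deflation_id : forall X, deflation (id_arr X);
  exact_inflation_comp : forall X Y Z (i : arr X Y) (j : arr Y Z),
    inflation i -> inflation j -> inflation (j \oc i);
  exact_deflation_comp : forall X Y Z (p : arr X Y) (q : arr Y Z),
    deflation p -> deflation q -> deflation (q \oc p);
  exact_pushout : forall X Y X' (i : arr X Y) (f : arr X X'), inflation i ->
    exists Y' (i' : arr X' Y') (f' : arr Y Y'),
      is_pushout i f i' f' /\ inflation i';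
  exact_pullback : forall Y Z Z' (p : arr Y Z) (f : arr Z' Z), deflation p ->
    exists Y' (p' : arr Y' Z') (f' : arr Y' Y),
      is_pullback p f p' f' /\ deflation p'
}.

Definition projective_object (P : C) : Prop :=
  forall Y Z (p : arr Y Z) (f : arr P Z), deflation p ->
    exists u : arr P Y, p \oc u = f.

Definition injective_object (I : C) : Prop :=
  forall X Y (i : arr X Y) (f : arr X I), inflation i ->
    exists u : arr Y I, u \oc i = f.

Definition enough_projectives : Prop :=
  forall X, exists P (p : arr P X), projective_object P /\ deflation p.

Definition enough_injectives : Prop :=
  forall X, exists I (i : arr X I), injective_object I /\ inflation i.

Record frobenius_category : Prop := FrobeniusCategory {
  frobenius_exact : exact_category;
  frobenius_enough_proj : enough_projectives;
  frobenius_enough_inj : enough_injectives;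
  frobenius_proj_inj : forall X, projective_object X <-> injective_object X
}.

End ExactCategories.

Definition restrict_class (C : preadditive) (E : pair_class C) (D : C -> Prop) :
    pair_class (full_sub D) :=
  fun X Y Z i p => @E (sval X) (sval Y) (sval Z) i p.

(* [D] is a full subcategory of [D'] (both inside [C]) which is Frobenius for
   the exact structure formed by the pairs of [E] with all terms in [D]. *)
Definition frobenius_subcategory (C : preadditive) (E : pair_class C)
    (D D' : C -> Prop) : Prop :=
  (forall X, D X -> D' X) /\ frobenius_category (restrict_class E (D := D)).

Definition projective_in (C : preadditive) (E : pair_class C) (D : C -> Prop)
    (X : C) : Prop :=
  exists DX : D X, projective_object (restrict_class E (D := D)) (exist D X DX).

Section Rings.

Variable S : comNzRingType.

Definition is_ideal (I : S -> Prop) : Prop :=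
  [/\ I 0, forall x y, I x -> I y -> I (x + y) & forall a x, I x -> I (a * x)].

Definition noetherian_ring : Prop :=
  forall I, is_ideal I -> exists (k : nat) (a : 'I_k -> S),
    forall x, I x <-> exists c : 'I_k -> S, x = \sum_i c i * a i.

Definition maximal_ideal (m : S -> Prop) : Prop :=
  [/\ is_ideal m, ~ m 1
    & forall J, is_ideal J -> ~ J 1 -> (forall x, m x -> J x) ->
      forall x, J x -> m x].

Definition local_ring (n : S -> Prop) : Prop :=
  maximal_ideal n /\ forall m, maximal_ideal m -> forall x, m x <-> n x.

End Rings.

Section Modules.

Variable S : comNzRingType.

Definition fin_gen (M : lmodType S) : Prop :=
  exists (k : nat) (e : 'I_k -> M),
    forall x, exists c : 'I_k -> S, x = \sum_i c i *: e i.

Record fgmod := FgMod { fgmod_lmod :> lmodType S; fgmodP : fin_gen fgmod_lmod }.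

Definition surjective (A B : Type) (f : A -> B) : Prop :=
  forall y, exists x, f x = y.

Definition projective_module (P : fgmod) : Prop :=
  forall (M N : lmodType S) (p : {linear M -> N}) (f : {linear P -> N}),
    surjective p -> exists u : {linear P -> M}, forall x, p (u x) = f x.

(* Complexes [... -> P i -> P (i + 1) -> ...] indexed by the integers. Exactness
   at every position is exactness at [P (i + 1)] for every [i]. *)
Definition acyclic (P : int -> fgmod)
    (d : forall i, {linear P i -> P (i + 1)}) : Prop :=
  forall i (x : P (i + 1)), d (i + 1) x = 0 <-> exists y, d i y = x.

(* Exactness of [Hom(P, Q)]: [d]-cocycles [f : P (i + 1) -> Q] (those vanishing
   on the image of [d i]) are exactly the maps that factor through [d (i + 1)]. *)
Definition hom_acyclic (P : int -> fgmod)
    (d : forall i, {linear P i -> P (i + 1)}) (Q : fgmod) : Prop :=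
  forall i (f : {linear P (i + 1) -> Q}),
    (forall x, f (d i x) = 0) <->
    (exists g : {linear P (i + 1 + 1) -> Q}, forall x, g (d (i + 1) x) = f x).

Definition totally_acyclic (P : int -> fgmod)
    (d : forall i, {linear P i -> P (i + 1)}) : Prop :=
  [/\ forall i, projective_module (P i), acyclic d
    & forall Q, projective_module Q -> hom_acyclic d Q].

(* [M] is isomorphic, via [j], to the kernel of [d 0], where [(P, d)] is a
   totally acyclic complex. *)
Definition gorenstein_projective (M : fgmod) : Prop :=
  exists (P : int -> fgmod) (d : forall i, {linear P i -> P (i + 1)})
         (j : {linear M -> P 0}),
    [/\ totally_acyclic d, injective j
      & forall x, d 0 x = 0 <-> exists y, j y = x].

End Modules.

Section MorphismCategory.

Variable S : comNzRingType.

Record mor_obj := MorObj {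
  mor_src : fgmod S;
  mor_tgt : fgmod S;
  mor_map : {linear mor_src -> mor_tgt}
}.

Record mor_hom (X Y : mor_obj) := MorHom {
  hom1 : {linear mor_src X -> mor_src Y};
  hom0 : {linear mor_tgt X -> mor_tgt Y};
  hom_comm : forall x, hom0 (mor_map X x) = mor_map Y (hom1 x)
}.

Lemma linear_eq (U V : lmodType S) (f g : {linear U -> V}) : f =1 g -> f = g.
Proof.
case: f => f [[f1] [f2]]; case: g => g [[g1] [g2]] /= fg.
have {}fg : f = g by apply: funext.
case: _ / fg in g1 g2 *.
by rewrite (Prop_irrelevance f1 g1) (Prop_irrelevance f2 g2).
Qed.

Lemma mor_hom_eq X Y (f g : mor_hom X Y) :
  hom1 f =1 hom1 g -> hom0 f =1 hom0 g -> f = g.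
Proof.
case: f => f1 f0 fc; case: g => g1 g0 gc /= /linear_eq E1 /linear_eq E0.
case: _ / E1 in gc *; case: _ / E0 in gc *.
by rewrite (Prop_irrelevance fc gc).
Qed.

Section HomGroup.

Variables X Y : mor_obj.

HB.instance Definition _ := gen_eqMixin (mor_hom X Y).
HB.instance Definition _ := gen_choiceMixin (mor_hom X Y).

Lemma mor_zero_comm x :
  (\0 : {linear mor_tgt X -> mor_tgt Y}) (mor_map X x)
  = mor_map Y ((\0 : {linear mor_src X -> mor_src Y}) x).
Proof. by rewrite /= linear0. Qed.

Definition mor_zero : mor_hom X Y := @MorHom X Y \0 \0 mor_zero_comm.

Lemma mor_opp_comm (f : mor_hom X Y) x :
  (\- hom0 f) (mor_map X x) = mor_map Y ((\- hom1 f) x).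
Proof. by rewrite /= hom_comm linearN. Qed.

Definition mor_opp (f : mor_hom X Y) : mor_hom X Y :=
  @MorHom X Y (\- hom1 f) (\- hom0 f) (mor_opp_comm f).

Lemma mor_add_comm (f g : mor_hom X Y) x :
  (hom0 f \+ hom0 g) (mor_map X x) = mor_map Y ((hom1 f \+ hom1 g) x).
Proof. by rewrite /= !hom_comm linearD. Qed.

Definition mor_add (f g : mor_hom X Y) : mor_hom X Y :=
  @MorHom X Y (hom1 f \+ hom1 g) (hom0 f \+ hom0 g) (mor_add_comm f g).

Lemma mor_addA : associative mor_add.
Proof. by move=> f g h; apply: mor_hom_eq => x /=; rewrite addrA. Qed.

Lemma mor_addC : commutative mor_add.
Proof. by move=> f g; apply: mor_hom_eq => x /=; rewrite addrC. Qed.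

Lemma mor_add0 : left_id mor_zero mor_add.
Proof. by move=> f; apply: mor_hom_eq => x /=; rewrite add0r. Qed.

Lemma mor_addN : left_inverse mor_zero mor_opp mor_add.
Proof. by move=> f; apply: mor_hom_eq => x /=; rewrite addNr. Qed.

HB.instance Definition _ := GRing.isZmodule.Build (mor_hom X Y)
  mor_addA mor_addC mor_add0 mor_addN.

End HomGroup.

Definition mor_id (X : mor_obj) : mor_hom X X :=
  @MorHom X X idfun idfun (fun=> erefl).

Lemma mor_comp_comm X Y Z (g : mor_hom Y Z) (f : mor_hom X Y) x :
  (hom0 g \o hom0 f) (mor_map X x) = mor_map Z ((hom1 g \o hom1 f) x).
Proof. by rewrite /= !hom_comm. Qed.

Definition mor_comp X Y Z (g : mor_hom Y Z) (f : mor_hom X Y) : mor_hom X Z :=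
  @MorHom X Z (hom1 g \o hom1 f) (hom0 g \o hom0 f) (mor_comp_comm g f).

Lemma mor_compA X Y Z T (h : mor_hom Z T) (g : mor_hom Y Z) (f : mor_hom X Y) :
  mor_comp h (mor_comp g f) = mor_comp (mor_comp h g) f.
Proof. exact: mor_hom_eq. Qed.

Lemma mor_compf1 X Y (f : mor_hom X Y) : mor_comp f (mor_id X) = f.
Proof. exact: mor_hom_eq. Qed.

Lemma mor_comp1f X Y (f : mor_hom X Y) : mor_comp (mor_id Y) f = f.
Proof. exact: mor_hom_eq. Qed.

Lemma mor_compDl X Y Z (g g' : mor_hom Y Z) (f : mor_hom X Y) :
  mor_comp (g + g') f = mor_comp g f + mor_comp g' f.
Proof. exact: mor_hom_eq. Qed.

Lemma mor_compDr X Y Z (g : mor_hom Y Z) (f f' : mor_hom X Y) :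
  mor_comp g (f + f') = mor_comp g f + mor_comp g f'.
Proof. by apply: mor_hom_eq => x /=; rewrite linearD. Qed.

Definition Mor : preadditive :=
  @Preadditive mor_obj (fun X Y => mor_hom X Y : zmodType) mor_id mor_comp
    mor_compA mor_compf1 mor_comp1f mor_compDl mor_compDr.

Definition short_exact (U V W : lmodType S)
    (f : {linear U -> V}) (g : {linear V -> W}) : Prop :=
  [/\ injective f, surjective g & forall y, g y = 0 <-> exists x, f x = y].

Definition mor_short_exact : pair_class Mor :=
  fun (X Y Z : mor_obj) (f : mor_hom X Y) (g : mor_hom Y Z) =>
    short_exact (hom1 f) (hom1 g) /\ short_exact (hom0 f) (hom0 g).

(* [w] kills [Coker f]: the class of [y] in [N / im f] is zero if and only if
   [y] lies in [im f]. *)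
Definition kills_coker (w : S) (M N : lmodType S) (f : {linear M -> N}) : Prop :=
  forall y, exists x, f x = w *: y.

Definition MonG (w : S) (X : Mor) : Prop :=
  [/\ injective (mor_map X), gorenstein_projective (mor_src X),
      projective_module (mor_tgt X) & kills_coker w (mor_map X)].

Definition MonP (w : S) (X : Mor) : Prop :=
  [/\ injective (mor_map X), projective_module (mor_src X),
      projective_module (mor_tgt X) & kills_coker w (mor_map X)].

End MorphismCategory.

(* Main.v *)
Require Import Defs.
From mathcomp Require Import all_boot all_algebra.
From HB Require Import structures.
From mathcomp Require Import boolp.

(* Call a class X of finitely generated modules good if it contains the
   projectives, is closed under extensions, has Ext^1(M, Q) = 0 for M in X and Q
   projective, and if every M in X is both a submodule and a quotient of a
   projective, with cokernel resp. kernel in X. For a good X let Mon X be the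
   category of monomorphisms f : G -> P with G in X, P projective and
   w Coker f = 0. There is then a unique h : P -> G with f h = w and h f = w.

   Mon X is closed under extensions in Mor, and also under the cokernels and
   kernels needed for Quillen's axioms: w kills the cokernel of a quotient for
   free, and of a kernel because the pairs (f, h) are natural. The objects
   std P Q = (P = P) + (Q -w-> Q) are projective and injective. An object
   f : G -> P is a quotient of std P' P through P' ->> G and h, and a subobject
   of std P Q through f and G >-> Q. Hence the projective objects and the injective
   objects of Mon X are both the retracts of the objects std P Q, whatever X is.

   The projectives form a good class. So do the Gorenstein projectives: they are
   the largest class satisfying the last three conditions (splice the short
   exact sequences into a complete resolution), and these conditions pass to the class
   of extensions of two of its members by the horseshoe construction. *)

Set Implicit Arguments.
Unset Strict Implicit.
Unset Printing Implicit Defensive.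

Import GRing.Theory.
Local Open Scope ring_scope.
Local Open Scope quotient_scope.

(** * Submodules and quotients *)

Section LinearMaps.

Variable S : comNzRingType.
Implicit Types U V W : lmodType S.

Definition mk_linear U V (f : U -> V) (Hf : linear f) : {linear U -> V} :=
  HB.pack f (GRing.isLinear.Build S U V *:%R f Hf).

(** Two preimages of a point differ by an element of the kernel of [s], so [f] composed with a
    chosen section is linear although the section itself need not be. *)
Lemma factor_surj U V W (s : {linear U -> V}) (f : {linear U -> W}) :
  surjective s -> (forall x, s x = 0 -> f x = 0) ->
  exists g : {linear V -> W}, forall x, g (s x) = f x.
Proof.
move=> /choice[r rK] sf.
have fr x : f (r (s x)) = f x.
  by apply/eqP; rewrite -subr_eq0 -linearB sf // linearB rK subrr.
have lin : linear (f \o r).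
  by move=> a x y /=; rewrite -linearP -[RHS]fr linearP !rK.
by exists (mk_linear lin).
Qed.

Lemma factor_inj U V W (i : {linear U -> V}) (f : {linear W -> V}) :
  injective i -> (forall x, exists y, i y = f x) ->
  exists g : {linear W -> U}, forall x, i (g x) = f x.
Proof.
move=> inj /choice[g gK].
have lin : linear g by move=> a x y; apply: inj; rewrite linearP !gK linearP.
by exists (mk_linear lin).
Qed.

Definition is_submodule U (N : U -> Prop) : Prop :=
  N 0 /\ forall a x y, N x -> N y -> N (a *: x + y).

Section Submodule.

Variables (U : lmodType S) (N : U -> Prop) (HN : is_submodule N).

(** The proof [HN] is an argument so that the closure properties can be inferred from the predicate
    itself. *)
Definition sub_pred of is_submodule N : {pred U} := fun x => `[< N x >].

Lemma sub_pred_closed : submod_closed (sub_pred HN).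
Proof.
case: (HN) => N0 NL; split; first exact/asboolP.
by move=> a x y /asboolP Nx /asboolP Ny; apply/asboolP; apply: NL.
Qed.

HB.instance Definition _ :=
  GRing.isSubmodClosed.Build S U (sub_pred HN) sub_pred_closed.

Record sub_mod := SubMod { sub_val : U; _ : sub_val \in sub_pred HN }.

HB.instance Definition _ := [isSub for sub_val].
HB.instance Definition _ := [Choice of sub_mod by <:].
HB.instance Definition _ := [SubChoice_isSubLmodule of sub_mod by <:].

Definition quot_mod := Quotient.quot (sub_pred HN).

HB.instance Definition _ := GRing.Zmodule.on quot_mod.

Definition quot_pi (x : U) : quot_mod := \pi_(Quotient.quot (sub_pred HN)) x.
Definition quot_repr (x : quot_mod) : U := repr x.

Lemma quot_reprK : cancel quot_repr quot_pi.
Proof. exact: reprK. Qed.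

Lemma quot_eq (x y : U) : quot_pi x = quot_pi y <-> N (x - y).
Proof.
split=> [/eqP|Nxy]; first by rewrite piE /= /Quotient.equiv => /asboolP.
by apply/eqP; rewrite piE; apply/asboolP.
Qed.

Lemma quot_piD x y : quot_pi (x + y) = quot_pi x + quot_pi y.
Proof. exact: (raddfD \pi_(Quotient.quot (sub_pred HN))). Qed.

Definition quot_scale (a : S) (x : quot_mod) := quot_pi (a *: quot_repr x).

(** The chosen representative of [quot_pi x] differs from [x] by an element of [N], and [N] is
    stable under scaling. *)
Lemma quot_scale_pi a x : quot_scale a (quot_pi x) = quot_pi (a *: x).
Proof.
case: (HN) => N0 NL; apply/quot_eq; rewrite -scalerBr -[_ *: _]addr0.
by apply: (NL) => //; apply/quot_eq; rewrite quot_reprK.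
Qed.

Lemma quot_scaleA a b x : quot_scale a (quot_scale b x) = quot_scale (a * b) x.
Proof. by rewrite -[x]quot_reprK !quot_scale_pi scalerA. Qed.

Lemma quot_scale1 : left_id 1 quot_scale.
Proof. by move=> x; rewrite -[x]quot_reprK !quot_scale_pi scale1r. Qed.

Lemma quot_scaleDr : right_distributive quot_scale +%R.
Proof.
move=> a x y; rewrite -[x]quot_reprK -[y]quot_reprK -quot_piD !quot_scale_pi.
by rewrite scalerDr quot_piD.
Qed.

Lemma quot_scaleDl x : {morph quot_scale^~ x : a b / a + b}.
Proof.
by move=> a b; rewrite -[x]quot_reprK !quot_scale_pi scalerDl quot_piD.
Qed.

HB.instance Definition _ := GRing.Zmodule_isLmodule.Build S quot_mod
  quot_scaleA quot_scale1 quot_scaleDr quot_scaleDl.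

End Submodule.

Lemma exists_submodule U (N : U -> Prop) : is_submodule N ->
  exists (K : lmodType S) (i : {linear K -> U}),
    injective i /\ forall x, N x <-> exists y, i y = x.
Proof.
move=> HN; exists (sub_mod HN), (val : {linear sub_mod HN -> U}).
split=> [|x]; first exact: val_inj.
split=> [/asboolP Nx|[y <-]]; first by exists (@SubMod _ _ HN x Nx).
by apply/asboolP; apply: valP y.
Qed.

Lemma exists_quotient U (N : U -> Prop) : is_submodule N ->
  exists (Q : lmodType S) (p : {linear U -> Q}),
    surjective p /\ forall x, p x = 0 <-> N x.
Proof.
move=> HN; have lin : linear (quot_pi HN).
  by move=> a x y; rewrite quot_piD -quot_scale_pi.
exists (quot_mod HN), (mk_linear lin); split=> [y|x] /=.
  by exists (quot_repr y); apply: quot_reprK.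
have pi0 : quot_pi HN 0 = 0.
  exact: (raddf0 \pi_(Quotient.quot (sub_pred HN))).
by rewrite -pi0 quot_eq subr0.
Qed.

Lemma exists_coker U V (f : {linear U -> V}) : injective f ->
  exists (Q : lmodType S) (p : {linear V -> Q}), short_exact f p.
Proof.
move=> f_inj; have HN : is_submodule (fun y => exists x, f x = y).
  split=> [|a _ _ [x <-] [y <-]]; first by exists 0; rewrite linear0.
  by exists (a *: x + y); rewrite linearP.
by have [Q [p [p_surj pE]]] := exists_quotient HN; exists Q, p.
Qed.

Lemma exists_ker U V (f : {linear U -> V}) : surjective f ->
  exists (K : lmodType S) (i : {linear K -> U}), short_exact i f.
Proof.
move=> f_surj; have HN : is_submodule (fun x => f x = 0).
  by split=> [|a x y]; rewrite ?linear0 // linearP => -> ->;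
    rewrite scaler0 addr0.
by have [K [i [i_inj iE]]] := exists_submodule HN; exists K, i.
Qed.

End LinearMaps.

(** * Finitely generated modules *)

Section FinGen.

Variable S : comNzRingType.
Implicit Types U V W M : lmodType S.

Lemma fin_gen_surj U V (p : {linear U -> V}) :
  surjective p -> fin_gen U -> fin_gen V.
Proof.
move=> p_surj [k [e eP]]; exists k, (p \o e) => y.
have [x <-] := p_surj y; have [c ->] := eP x.
by exists c; rewrite linear_sum; apply: eq_bigr => i _; rewrite linearZ.
Qed.

(** The clause on predicates lets the joint family inherit membership in a submodule without a case
    split on the index; the induction below keeps its generators in [N] this way. *)
Lemma span_cat M m1 m2 (g1 : 'I_m1 -> M) (g2 : 'I_m2 -> M) :
  exists g : 'I_(m1 + m2) -> M,
    (forall P : M -> Prop,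
       (forall j, P (g1 j)) -> (forall j, P (g2 j)) -> forall j, P (g j)) /\
    forall (c1 : 'I_m1 -> S) (c2 : 'I_m2 -> S), exists c : 'I_(m1 + m2) -> S,
      \sum_i c i *: g i = \sum_i c1 i *: g1 i + \sum_i c2 i *: g2 i.
Proof.
pose glue T (u1 : 'I_m1 -> T) u2 (i : 'I_(m1 + m2)) :=
  match split i with inl j => u1 j | inr j => u2 j end.
have glue1 T (u1 : 'I_m1 -> T) u2 j : glue T u1 u2 (lshift m2 j) = u1 j.
  by rewrite /glue (unsplitK (inl j)).
have glue2 T (u1 : 'I_m1 -> T) u2 j : glue T u1 u2 (rshift m1 j) = u2 j.
  by rewrite /glue (unsplitK (inr j)).
exists (glue M g1 g2); split=> [P P1 P2 j|c1 c2].
  by rewrite /glue; case: (split j).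
exists (glue S c1 c2); rewrite big_split_ord /=.
by congr (_ + _); apply: eq_bigr => i _; rewrite ?glue1 ?glue2.
Qed.

Lemma fin_gen_prod U V : fin_gen U -> fin_gen V -> fin_gen (U * V)%type.
Proof.
move=> [k1 [e1 e1P]] [k2 [e2 e2P]].
have [g [_ gP]] := span_cat (fun i => (e1 i, 0 : V)) (fun i => (0 : U, e2 i)).
exists (k1 + k2)%N, g => -[x y].
have [c1 ->] := e1P x; have [c2 ->] := e2P y; have [c cE] := gP c1 c2.
exists c; rewrite cE.
have -> : \sum_i c1 i *: (e1 i, 0 : V) = (\sum_i c1 i *: e1 i, 0).
  rewrite (big_morph (fun x => (x, 0 : V)) (id1 := 0) (op1 := +%R)) //=.
    by apply: eq_bigr => i _; congr (_, _); rewrite scaler0.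
  by move=> a b; congr (_, _); rewrite addr0.
have -> : \sum_i c2 i *: (0 : U, e2 i) = (0, \sum_i c2 i *: e2 i).
  rewrite (big_morph (fun x => (0 : U, x)) (id1 := 0) (op1 := +%R)) //=.
    by apply: eq_bigr => i _; congr (_, _); rewrite scaler0.
  by move=> a b; congr (_, _); rewrite addr0.
by congr (_, _); rewrite /= ?addr0 ?add0r.
Qed.

Lemma fin_gen_rV k : fin_gen 'rV[S]_k.
Proof.
exists k, (delta_mx 0) => x; exists (x 0); exact: row_sum_delta.
Qed.

Lemma free_cover M : fin_gen M ->
  exists k (p : {linear 'rV[S]_k -> M}), surjective p.
Proof.
move=> [k [e eP]]; pose p (v : 'rV[S]_k) := \sum_i v 0 i *: e i.
have lin : linear p.
  move=> a x y; rewrite /p scaler_sumr -big_split /=; apply: eq_bigr => i _.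
  by rewrite !mxE scalerDl scalerA.
exists k, (mk_linear lin) => y; have [c ->] := eP y.
by exists (\row_i c i) => /=; apply: eq_bigr => i _; rewrite mxE.
Qed.

(* Induction on k: the coefficients at e ord0 of the elements of N form an
   ideal, and lifting its generators to N reduces to the remaining vectors. *)
Lemma noetherian_span M (N : M -> Prop) k (e : 'I_k -> M) :
  noetherian_ring S -> is_submodule N ->
  (forall x, N x -> exists c : 'I_k -> S, x = \sum_i c i *: e i) ->
  exists m (g : 'I_m -> M), (forall j, N (g j)) /\
    forall x, N x -> exists c : 'I_m -> S, x = \sum_j c j *: g j.
Proof.
move=> noeth; elim: k e N => [|k IHk] e N HN Ne.
  by exists 0%N, e; split=> [[]//|x]; apply: Ne.
case: (HN) => N0 NL.
have Nsum m (c : 'I_m -> S) (y : 'I_m -> M) :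
    (forall j, N (y j)) -> N (\sum_j c j *: y j).
  by move=> Ny; apply: big_ind => // [x z Nx Nz|i _];
    [rewrite -[x]scale1r; apply: NL|rewrite -[_ *: _]addr0; apply: NL].
pose tail (c : 'I_k -> S) := \sum_i c i *: e (lift ord0 i).
pose I a := exists c, N (a *: e ord0 + tail c).
have tailL b c c' : tail (fun i => b * c i + c' i) = b *: tail c + tail c'.
  rewrite /tail scaler_sumr -big_split /=; apply: eq_bigr => i _.
  by rewrite scalerDl scalerA.
have tail0 : tail (fun=> 0) = 0.
  by rewrite /tail big1 // => i _; rewrite scale0r.
have I0 : I 0 by exists (fun=> 0); rewrite tail0 scale0r addr0.
have IL b a a' : I a -> I a' -> I (b * a + a').
  move=> [c Nc] [c' Nc']; exists (fun i => b * c i + c' i).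
  by rewrite tailL scalerDl -scalerA addrACA -scalerDr; apply: NL.
have idI : is_ideal I.
  split=> // [x y Ix Iy|a x Ix]; first by rewrite -[x]mul1r; apply: IL.
  by rewrite -[_ * _]addr0; apply: IL.
have [m [a aP]] := noeth I idI.
have /choice[c yN] j : I (a j).
  apply/aP; exists (fun i => (i == j)%:R).
  rewrite (bigD1 j) //= eqxx mul1r big1 ?addr0 // => i /negPf ->.
  by rewrite mul0r.
pose y j := a j *: e ord0 + tail (c j).
pose N' x := N x /\ exists c, x = tail c.
have HN' : is_submodule N'.
  split=> [|b x z [Nx [c1 xE]] [Nz [c2 zE]]].
    by split=> //; exists (fun=> 0).
  split; first exact: NL.
  by exists (fun i => b * c1 i + c2 i); rewrite tailL xE zE.
have [m' [g [gN gP]]] := IHk (e \o lift ord0) N' HN' (fun x => @proj2 _ _).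
have [h [hN hP]] := span_cat y g.
exists (m + m')%N, h; split; first by apply: hN => // j; case: (gN j).
move=> x Nx; have [d dE] := Ne x Nx; rewrite big_ord_recl in dE.
have /aP[b bE] : I (d ord0).
  by exists (d \o lift ord0); rewrite -[_ + _]dE.
(* Subtracting this combination of the [y j] cancels the coefficient at [e ord0], so the remainder
   lies in [N']. *)
have [|c' c'E] := gP (x - \sum_j b j *: y j).
  split.
    by rewrite addrC -scaleN1r; apply: NL => //; apply: Nsum.
  exists (fun i => (-1) * (\sum_j b j * c j i) + d (lift ord0 i)).
  rewrite tailL scaleN1r [RHS]addrC dE bE.
  rewrite [X in _ - X](_ : _ =
      (\sum_j b j * a j) *: e ord0 + \sum_j b j *: tail (c j)).
    rewrite opprD addrACA subrr add0r; congr (_ - _).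
    rewrite /tail; under eq_bigr => j _ do rewrite scaler_sumr.
    rewrite exchange_big /=; apply: eq_bigr => i _; rewrite scaler_suml.
    by apply: eq_bigr => j _; rewrite scalerA.
  rewrite scaler_suml -big_split /=; apply: eq_bigr => j _.
  by rewrite /y scalerDr scalerA.
have [c'' c''E] := hP b c'.
by exists c''; rewrite c''E -c'E addrC subrK.
Qed.

Lemma fin_gen_sub U V (i : {linear U -> V}) :
  noetherian_ring S -> injective i -> fin_gen V -> fin_gen U.
Proof.
move=> noeth i_inj [k [e eP]].
have HN : is_submodule (fun x => exists y, i y = x).
  split=> [|a _ _ [x <-] [y <-]]; first by exists 0; rewrite linear0.
  by exists (a *: x + y); rewrite linearP.
have [m [g [/choice[h hg] gP]]] := noetherian_span noeth HN (fun x _ => eP x).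
exists m, h => x; have [|c cE] := gP (i x); first by exists x.
exists c; apply: i_inj; rewrite cE linear_sum.
by apply: eq_bigr => j _; rewrite linearZ /= hg.
Qed.

End FinGen.

(** * Short exact sequences and projective modules *)

Section ShortExact.

Variable S : comNzRingType.
Implicit Types U V W : lmodType S.

Lemma linear_injP U V (f : {linear U -> V}) :
  injective f <-> forall x, f x = 0 -> x = 0.
Proof.
split=> [f_inj x fx0|f0 x y xy]; first by apply: f_inj; rewrite linear0.
by apply/subr0_eq/f0; rewrite linearB xy subrr.
Qed.

Lemma short_exact_comp0 U V W (f : {linear U -> V}) (g : {linear V -> W}) x :
  short_exact f g -> g (f x) = 0.
Proof. by case=> _ _ E; apply/E; exists x. Qed.

Lemma inl_linear U V : linear (fun x : U => (x, 0 : V)).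
Proof. by move=> a x y; congr (_, _); rewrite /= scaler0 addr0. Qed.

Lemma inr_linear U V : linear (fun y : V => (0 : U, y)).
Proof. by move=> a x y; congr (_, _); rewrite /= scaler0 addr0. Qed.

Definition in_left U V : {linear U -> (U * V)%type} :=
  mk_linear (@inl_linear U V).
Definition in_right U V : {linear V -> (U * V)%type} :=
  mk_linear (@inr_linear U V).
Definition pr_left U V : {linear (U * V)%type -> U} := fst.
Definition pr_right U V : {linear (U * V)%type -> V} := snd.

Lemma short_exact_left U V : short_exact (in_left U V) (pr_right U V).
Proof.
split=> [x y []|y|[x y]] //=; first by exists (0, y).
by split=> [->|[z [_ ->]]] //; exists x.
Qed.

(* The maps pU, pV, pW (resp. kU, kV, kW) are the lower (resp. upper) halves of
   the columns of a 3x3 diagram with middle row f1, g1. What the 3x3 lemma needs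
   from the other halves is stated on elements, so that columns with a zero or
   identity entry need no separate treatment. *)
Definition coker_compatible (U1 V1 W1 U2 V2 W2 : lmodType S)
    (f1 : {linear U1 -> V1}) (g1 : {linear V1 -> W1}) (pU : {linear U1 -> U2})
    (pV : {linear V1 -> V2}) (pW : {linear W1 -> W2}) : Prop :=
  [/\ forall x, pU x = 0 <-> pV (f1 x) = 0,
      forall y, pV y = 0 -> pW (g1 y) = 0
    & forall z, pW z = 0 -> exists2 y, g1 y = z & pV y = 0].

Definition ker_compatible (U1 V1 W1 U2 V2 W2 : lmodType S)
    (f1 : {linear U1 -> V1}) (g1 : {linear V1 -> W1}) (kU : {linear U2 -> U1})
    (kV : {linear V2 -> V1}) (kW : {linear W2 -> W1}) : Prop :=
  [/\ forall x, (exists x', kU x' = x) <-> exists y', kV y' = f1 x,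
      forall y', exists z', kW z' = g1 (kV y')
    & forall z', exists y', kW z' = g1 (kV y')].

Lemma coker_short_exact U1 V1 W1 U2 V2 W2
    (f1 : {linear U1 -> V1}) (g1 : {linear V1 -> W1})
    (pU : {linear U1 -> U2}) (pV : {linear V1 -> V2}) (pW : {linear W1 -> W2}) :
  short_exact f1 g1 -> surjective pU -> surjective pV -> surjective pW ->
  coker_compatible f1 g1 pU pV pW ->
  exists (f2 : {linear U2 -> V2}) (g2 : {linear V2 -> W2}),
    [/\ short_exact f2 g2, forall x, f2 (pU x) = pV (f1 x)
      & forall y, g2 (pV y) = pW (g1 y)].
Proof.
move=> se1 pU_s pV_s pW_s [kerU kerV kerW]; have [_ g1_s ex1] := se1.
have [f2 f2E] := @factor_surj _ _ _ _ pU (pV \o f1) pU_s (fun x => (kerU x).1).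
have [g2 g2E] := @factor_surj _ _ _ _ pV (pW \o g1) pV_s kerV.
exists f2, g2; split=> //; split=> [|z|y].
- apply/linear_injP => x'; have [x <-] := pU_s x'.
  by rewrite f2E => /kerU.
- have [z1 <-] := pW_s z; have [y <-] := g1_s z1.
  by exists (pV y); rewrite g2E.
- split=> [|[x' <-]]; last first.
    have [x <-] := pU_s x'; rewrite f2E g2E /=.
    by rewrite (short_exact_comp0 _ se1) linear0.
  (* [y2] agrees with [y1] in [W1] and dies in [V2], so [y1 - y2] represents the same element and
     comes from [U1]. *)
  have [y1 <-] := pV_s y; rewrite g2E => /kerW[y2 /= y21 y20].
  have /ex1[x xE] : g1 (y1 - y2) = 0 by rewrite linearB /= y21 subrr.
  by exists (pU x); rewrite f2E /= xE linearB /= y20 subr0.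
Qed.

Lemma ker_short_exact U1 V1 W1 U2 V2 W2
    (f1 : {linear U1 -> V1}) (g1 : {linear V1 -> W1})
    (kU : {linear U2 -> U1}) (kV : {linear V2 -> V1}) (kW : {linear W2 -> W1}) :
  short_exact f1 g1 -> injective kU -> injective kV -> injective kW ->
  ker_compatible f1 g1 kU kV kW ->
  exists (f2 : {linear U2 -> V2}) (g2 : {linear V2 -> W2}),
    [/\ short_exact f2 g2, forall x', kV (f2 x') = f1 (kU x')
      & forall y', kW (g2 y') = g1 (kV y')].
Proof.
move=> se1 kU_i kV_i kW_i [imU imV imW]; have [f1_i _ ex1] := se1.
have [|f2 f2E] := @factor_inj _ _ _ _ kV (f1 \o kU) kV_i.
  by move=> x'; apply/imU; exists x'.
have [g2 g2E] := @factor_inj _ _ _ _ kW (g1 \o kV) kW_i imV.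
exists f2, g2; split=> //; split=> [x y xy|z'|y'].
- by apply/kU_i/f1_i; rewrite -[f1 _]f2E -[RHS]f2E xy.
- by have [y' y'E] := imW z'; exists y'; apply: kW_i; rewrite g2E.
- split=> [y'0|[x' <-]]; last first.
    by apply: kW_i; rewrite g2E /= f2E (short_exact_comp0 _ se1) linear0.
  have /ex1[x xE] : g1 (kV y') = 0 by rewrite -[LHS]g2E y'0 linear0.
  have /imU[x' x'E] : exists y', kV y' = f1 x by exists y'.
  by exists x'; apply: kV_i; rewrite f2E /= x'E.
Qed.

End ShortExact.

Section ProjectiveModules.

Variable S : comNzRingType.
Implicit Types U V W : lmodType S.
Implicit Types P Q M : fgmod S.

Definition prod_fgmod (P Q : fgmod S) : fgmod S :=
  FgMod (fin_gen_prod (fgmodP P) (fgmodP Q)).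

Definition zero_fgmod : fgmod S := FgMod (@fin_gen_rV S 0).

Lemma zero_fgmodE (x : zero_fgmod) : x = 0.
Proof. exact: thinmx0. Qed.

Lemma projective_zero : projective_module zero_fgmod.
Proof.
move=> M N p f _; exists \0 => x /=.
by rewrite linear0 (zero_fgmodE x) linear0.
Qed.

(** This is Ext^1(U, Q) = 0 for all projective [Q], phrased without Ext groups: maps to [Q] extend
    along every short exact sequence ending in [U]. *)
Definition ext1_proj U : Prop :=
  forall (K L : lmodType S) (i : {linear K -> L}) (p : {linear L -> U}),
  short_exact i p -> forall Q, projective_module Q ->
  forall f : {linear K -> Q},
  exists g : {linear L -> Q}, forall x, g (i x) = f x.

Lemma projective_ext1 P : projective_module P -> ext1_proj P.
Proof.
move=> projP K L i p [i_inj p_surj ex] Q _ f.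
have [s sK] := projP L P p idfun p_surj.
have [|r rK] := @factor_inj _ _ _ _ i (idfun \- (s \o p)) i_inj.
  by move=> y; apply/ex; rewrite /= linearB /= sK subrr.
exists (f \o r) => x /=; congr (f _); apply: i_inj; rewrite rK /=.
have /ex -> : exists y, i y = i x by exists x.
by rewrite linear0 subr0.
Qed.

(** A section of [p] makes [A * B] cover [E]; the lifts on the two factors descend to [E] because
    the covering map [c] has zero kernel. *)
Lemma projective_ext (A E B : fgmod S) (i : {linear A -> E})
    (p : {linear E -> B}) :
  short_exact i p -> projective_module A -> projective_module B ->
  projective_module E.
Proof.
move=> se projA projB M N q f q_surj; have [i_inj p_surj ex] := se.
have [s sK] := projB E B p idfun p_surj.
have [uA uAE] := projA M N q (f \o i) q_surj.
have [uB uBE] := projB M N q (f \o s) q_surj.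
pose c : {linear (A * B)%type -> E} :=
  (i \o pr_left A B) \+ (s \o pr_right A B).
have c_surj : surjective c.
  move=> y; have /ex[x xE] : p (y - s (p y)) = 0 by rewrite linearB /= sK subrr.
  by exists (x, p y); rewrite /c /= xE subrK.
pose u : {linear (A * B)%type -> M} :=
  (uA \o pr_left A B) \+ (uB \o pr_right A B).
have [|g gE] := @factor_surj _ _ _ _ c u c_surj.
  move=> [x y] /= xy0; have y0 : y = 0.
    have := congr1 p xy0; rewrite linearD linear0 /= sK.
    by rewrite (short_exact_comp0 _ se) add0r.
  move: xy0; rewrite y0 linear0 addr0 => /((linear_injP i).1 i_inj) ->.
  by rewrite !linear0 addr0.
exists g => y; have [[x z] <-] := c_surj y.
by rewrite gE /u /c /= !linearD /= uAE uBE.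
Qed.

Lemma projective_prod P Q : projective_module P -> projective_module Q ->
  projective_module (prod_fgmod P Q).
Proof.
exact: (@projective_ext P (prod_fgmod P Q) Q _ _ (short_exact_left P Q)).
Qed.

Lemma projective_retract P Q (s : {linear P -> Q}) (r : {linear Q -> P}) :
  (forall x, r (s x) = x) -> projective_module Q -> projective_module P.
Proof.
move=> sK projQ M N p f p_surj.
have [u uE] := projQ M N p (f \o r) p_surj.
by exists (u \o s) => x /=; rewrite uE /= sK.
Qed.

(** A projective module embeds by a section into a free module, where [w] is cancelled
    coordinatewise. *)
Lemma projective_regular P (w : S) : GRing.lreg w -> projective_module P ->
  forall x : P, w *: x = 0 -> x = 0.
Proof.
move=> w_reg projP x wx.
have [k [p p_surj]] := free_cover (fgmodP P).
have [s sK] := projP _ P p idfun p_surj.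
have sx0 : s x = 0.
  apply/rowP => j; apply: w_reg; rewrite mxE mulr0.
  have := congr1 (fun v : 'rV[S]_k => v 0 j) (congr1 s wx).
  by rewrite linearZ /= linear0 !mxE.
by rewrite -[x]sK sx0 linear0.
Qed.

End ProjectiveModules.

(** * Gorenstein projective modules *)

Section Gorenstein.

Variable S : comNzRingType.
Implicit Types U V W : lmodType S.
Implicit Types P Q M : fgmod S.

(** One presentation by a projective suffices to test Ext^1: it maps to any other sequence ending in
    [U], and [L] is the pushout of [k] and the induced map [r] on kernels. *)
Lemma ext1_presentation U (K : lmodType S) P (k : {linear K -> P})
    (q : {linear P -> U}) :
  short_exact k q -> projective_module P ->
  (forall Q, projective_module Q -> forall f : {linear K -> Q},
     exists g : {linear P -> Q}, forall x, g (k x) = f x) ->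
  ext1_proj U.
Proof.
move=> seP projP extP K' L i p seL Q projQ f.
have [i_inj p_surj exL] := seL; have [_ q_surj exP] := seP.
have [t tE] := projP _ _ p q p_surj.
have [|r rE] := @factor_inj _ _ _ _ i (t \o k) i_inj.
  by move=> x; apply/exL; rewrite /= tE (short_exact_comp0 _ seP).
have [g gE] := extP Q projQ (f \o r).
(* The kernel of [c] consists of the pairs [(- r z, k z)], and [u] vanishes on them because [g]
   extends [f \o r]. *)
pose c : {linear (K' * P)%type -> L} :=
  (i \o pr_left K' P) \+ (t \o pr_right K' P).
pose u : {linear (K' * P)%type -> Q} :=
  (f \o pr_left K' P) \+ (g \o pr_right K' P).
have c_surj : surjective c.
  move=> y; have [z zE] := q_surj (p y).
  have /exL[x xE] : p (y - t z) = 0 by rewrite linearB /= tE zE subrr.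
  by exists (x, z); rewrite /c /= xE subrK.
have [|h hE] := @factor_surj _ _ _ _ c u c_surj.
  move=> [x y] /= xy0; have /exP[z zE] : q y = 0.
    have := congr1 p xy0; rewrite linearD linear0 /= tE.
    by rewrite (short_exact_comp0 _ seL) add0r.
  have : x + r z = 0.
    by apply: (linear_injP i).1 => //; rewrite linearD /= rE /= zE.
  move/(congr1 f); rewrite linearD linear0 /= => fxz.
  by rewrite -zE gE /=.
exists h => x; have := hE (x, 0); rewrite /c /u /= !linear0 !addr0.
by [].
Qed.

(** The preimage [N] of [A] in [L] sits in sequences from [K] to [N] to [A] and from [N] to [L] to
    [B]; the map is extended first to [N], then to [L]. *)
Lemma ext1_extension (A E B : lmodType S) (i : {linear A -> E})
    (p : {linear E -> B}) :
  short_exact i p -> ext1_proj A -> ext1_proj B -> ext1_proj E.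
Proof.
move=> [i_inj p_surj ex] extA extB K L k q [k_inj q_surj exL] Q projQ f.
have [|N [n seN]] := @exists_ker _ _ _ (p \o q).
  move=> z; have [y <-] := p_surj z; have [x <-] := q_surj y.
  by exists x.
have [n_inj _ exN] := seN.
have [|k' k'E] := @factor_inj _ _ _ _ n k n_inj.
  move=> x; apply/exN => /=; rewrite (exL _).2 ?linear0 //; by exists x.
have [|q' q'E] := @factor_inj _ _ _ _ i (q \o n) i_inj.
  by move=> x; apply/ex; apply/exN; exists x.
have se' : short_exact k' q'.
  split=> [x y xy|a|x].
  - by apply: k_inj; rewrite -!k'E xy.
  - have [y yE] := q_surj (i a).
    have /exN[x xE] : (p \o q) y = 0 by rewrite /= yE; apply/ex; exists a.
    by exists x; apply: i_inj; rewrite q'E /= xE.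
  split=> [qx0|[y <-]].
    have /exL[y yE] : q (n x) = 0 by rewrite -[LHS]q'E qx0 linear0.
    by exists y; apply: n_inj; rewrite k'E.
  by apply: i_inj; rewrite q'E linear0 /= k'E; apply/exL; exists y.
have [g gE] := extA _ _ _ _ se' Q projQ f.
have [h hE] := extB _ _ _ _ seN Q projQ g.
by exists h => x; rewrite -k'E hE gE.
Qed.

(* Gorenstein projectivity characterized without complexes: it is the largest
   predicate satisfying these three conditions. *)
Record gorenstein_class (X : fgmod S -> Prop) : Prop := GorensteinClass {
  gc_ext1 : forall M, X M -> ext1_proj M;
  gc_coresolution : forall M, X M -> exists P M' (i : {linear M -> P})
    (p : {linear P -> M'}), [/\ projective_module P, short_exact i p & X M'];
  gc_resolution : forall M, X M -> exists P M' (i : {linear M' -> P})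
    (p : {linear P -> M}), [/\ projective_module P, short_exact i p & X M']
}.

(** Exactness is only stated at positions of the form [i + 1]; this turns a general index into such
    a form, so that the dependent types match by substitution. *)
Lemma int_pred (i : int) : exists k, i = k + 1.
Proof. by exists (i - 1); rewrite subrK. Qed.

Lemma gorenstein_class_sub X M :
  gorenstein_class X -> X M -> gorenstein_projective M.
Proof.
move=> [ext1X coresX resX] XM.
pose R (A B : fgmod S) := exists P (i : {linear A -> P}) (p : {linear P -> B}),
  projective_module P /\ short_exact i p.
have /choice[nxt nxtP] (A : {A | X A}) :
    exists B : {B | X B}, R (sval A) (sval B).
  have [P [B [i [p [projP se XB]]]]] := coresX _ (svalP A).
  by exists (exist _ B XB), P, i, p.
have /choice[prv prvP] (A : {A | X A}) :
    exists B : {B | X B}, R (sval B) (sval A).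
  have [P [B [i [p [projP se XB]]]]] := resX _ (svalP A).
  by exists (exist _ B XB), P, i, p.
(* The syzygies, with [M] at index 0. As [Negz n] is -(n + 1), it takes [n.+1] steps back. *)
pose Z (i : int) := match i with
  | Posz n => iter n nxt (exist _ M XM)
  | Negz n => iter n.+1 prv (exist _ M XM) end.
have ZR i : R (sval (Z i)) (sval (Z (i + 1))).
  case: i => [n|[|n]]; first by rewrite -PoszD addn1; apply: nxtP.
    by have -> : Negz 0 + 1 = Posz 0 by []; apply: prvP.
  have -> : Negz n.+1 + 1 = Negz n by rewrite !NegzE -addn1 PoszD opprD subrK.
  exact: prvP.
have /(_ _)/cid-/all_sig[P PR] := ZR.
have /(_ _)/cid-/all_sig[f fR] := PR.
have /(_ _)/cid-/all_sig[g gR] := fR.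
pose d i : {linear P i -> P (i + 1)} := f (i + 1) \o g i.
have f_inj i : injective (f i) by have [_ []] := gR i.
have exfg i x : g i x = 0 <-> exists y, f i y = x by have [_ []] := gR i.
have d0 i x : d i x = 0 <-> exists y, f i y = x.
  rewrite -exfg /d /=; split=> [|->]; last by rewrite linear0.
  by apply: (linear_injP _).1.
have imd i y : (exists x, f (i + 1) x = y) <-> exists x, d i x = y.
  split=> [[x <-]|[x <-]]; last by exists (g i x).
  have [_ [_ g_surj _]] := gR i; have [z <-] := g_surj x; by exists z.
exists P, d, (f 0); split; [|exact: f_inj|exact: d0].
split=> [i|i x|Q projQ i h]; first by have [] := gR i.
  by rewrite d0 imd.
split=> [hd|[u uE] x]; last first.
  by rewrite -uE (d0 _ _).2 ?linear0 //; apply/imd; exists x.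
(* A map killed by [d i] factors through the syzygy at [i + 2], which embeds in the next projective
   with cokernel the syzygy at [i + 3]; vanishing of Ext^1 there gives the extension. *)
have [_ seg] := gR (i + 1); have [_ g_surj _] := seg.
have [|h' h'E] := @factor_surj _ _ _ _ (g (i + 1)) h g_surj.
  by move=> x /exfg/imd[y <-].
have [_ seg'] := gR (i + 1 + 1).
have [u uE] := ext1X _ (svalP (Z (i + 1 + 1 + 1))) _ _ _ _ seg' Q projQ h'.
by exists u => x; rewrite /d /= uE h'E.
Qed.

(** The kernel may sit at any position [i], so that passing to a neighbouring syzygy moves the index
    instead of reindexing the complex. *)
Definition is_cycle_module M : Prop :=
  exists (P : int -> fgmod S) (d : forall i, {linear P i -> P (i + 1)}) i
         (j : {linear M -> P i}),
    [/\ totally_acyclic d, injective j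
      & forall x, d i x = 0 <-> exists y, j y = x].

Hypothesis noethS : noetherian_ring S.

Lemma cycle_gorenstein_class : gorenstein_class is_cycle_module.
Proof.
split=> M [P [d [i [j [[projP acP homP] j_inj jE]]]]].
(* Three steps back are needed: [M] is presented by the term before its own, the kernel [K] of that
   presentation is covered by the term before, and the cocycle condition involves one more
   differential. *)
- have [i1 ?] := int_pred i; subst i; have [i2 ?] := int_pred i1; subst i1.
  have [i3 ?] := int_pred i2; subst i2.
  have [|q qE] := @factor_inj _ _ _ _ j (d (i3 + 1 + 1)) j_inj.
    by move=> x; apply/jE/acP; exists x.
  have [|K [k seK]] := @exists_ker _ _ _ q.
    move=> y; have /acP[x xE] : d (i3 + 1 + 1 + 1) (j y) = 0.
      by apply/jE; exists y.
    by exists x; apply: j_inj; rewrite qE.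
  have [k_inj _ exK] := seK.
  have qd x : q (d _ x) = 0.
    by apply: j_inj; rewrite qE linear0; apply/acP; exists x.
  have [|e eE] := @factor_inj _ _ _ _ k (d (i3 + 1)) k_inj.
    by move=> x; apply/exK.
  apply: (ext1_presentation seK (projP _)) => Q projQ f.
  have [|g gE] := (homP Q projQ _ (f \o e)).1.
    move=> x /=; rewrite (_ : e (d i3 x) = 0) ?linear0 //.
    by apply: k_inj; rewrite eE linear0; apply/acP; exists x.
  exists g => x.
  have /acP[y yE] : d (i3 + 1 + 1) (k x) = 0.
    by rewrite -qE (short_exact_comp0 _ seK) linear0.
  by rewrite -yE gE /=; congr (f _); apply: k_inj; rewrite eE.
(* The cokernel of [j] is the image of [d i], which is the kernel of [d (i + 1)]. *)
- have [N [p se]] := exists_coker j_inj; have [_ p_surj exN] := se.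
  exists (P i), (FgMod (fin_gen_surj p_surj (fgmodP (P i)))), j, p.
  split=> //; exists P, d, (i + 1).
  have [|h hE] := @factor_surj _ _ _ _ p (d i) p_surj.
    by move=> x /exN/jE.
  exists h; split=> [//||x].
    apply/linear_injP => y; have [x <-] := p_surj y.
    by rewrite hE => /jE/exN.
  rewrite acP; split=> [[y <-]|[y <-]]; first by exists (p y).
  by have [z <-] := p_surj y; exists z.
(* The previous differential [d k] maps onto [M], with kernel again a cycle module. *)
- have [k ?] := int_pred i; subst i.
  have [|q qE] := @factor_inj _ _ _ _ j (d k) j_inj.
    by move=> x; apply/jE/acP; exists x.
  have [|K [n seK]] := @exists_ker _ _ _ q.
    move=> y; have /acP[x xE] : d (k + 1) (j y) = 0 by apply/jE; exists y.
    by exists x; apply: j_inj; rewrite qE.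
  have [n_inj _ exK] := seK.
  exists (P k), (FgMod (fin_gen_sub noethS n_inj (fgmodP (P k)))), n, q.
  split=> //; exists P, d, k, n; split=> // x.
  rewrite -exK -qE; split=> [|->]; last by rewrite linear0.
  exact: (linear_injP j).1.
Qed.

(** By [gorenstein_class_sub] every cycle module is Gorenstein projective, so the two predicates
    agree and the conditions transfer. *)
Lemma gorenstein_projective_class : gorenstein_class (@gorenstein_projective S).
Proof.
have sub M : gorenstein_projective M -> is_cycle_module M.
  by move=> [P [d [j H]]]; exists P, d, 0, j.
have sup M : is_cycle_module M -> gorenstein_projective M.
  exact: gorenstein_class_sub cycle_gorenstein_class.
have [ext1C coresC resC] := cycle_gorenstein_class.
split=> M /sub HM; first exact: ext1C.
  have [P [M' [i [p [projP se /sup HM']]]]] := coresC _ HM.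
  by exists P, M', i, p.
have [P [M' [i [p [projP se /sup HM']]]]] := resC _ HM.
by exists P, M', i, p.
Qed.

(** * Extensions and good classes of modules *)

Definition extension_of (X : fgmod S -> Prop) (E : fgmod S) : Prop :=
  exists (A B : fgmod S) (i : {linear A -> E}) (p : {linear E -> B}),
    [/\ short_exact i p, X A & X B].

(** Vanishing of Ext^1 at [B] extends [iA] to a map [f] on [E], and [(f, iB \o p)] embeds [E] in
    [PA * PB]; dually a lift [t] of [pB] through [p] gives a cover. By the 3x3 lemma the cokernel
    and the kernel are again extensions. *)
Lemma extension_gorenstein_class X :
  gorenstein_class X -> gorenstein_class (extension_of X).
Proof.
move=> [ext1X coresX resX]; split=> E [A [B [i [p [se XA XB]]]]];
  have [i_inj p_surj ex] := se.
- exact: ext1_extension se (ext1X _ XA) (ext1X _ XB).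
- have [PA [A' [iA [pA [projA seA XA']]]]] := coresX _ XA.
  have [PB [B' [iB [pB [projB seB XB']]]]] := coresX _ XB.
  have [iA_inj pA_surj exA] := seA; have [iB_inj pB_surj exB] := seB.
  have [f fE] := ext1X _ XB _ _ _ _ se PA projA iA.
  pose h : {linear E -> prod_fgmod PA PB} :=
    (in_left PA PB \o f) \+ (in_right PA PB \o (iB \o p)).
  have hE x : h x = (f x, iB (p x)) by congr (_, _); rewrite /= ?addr0 ?add0r.
  have h_inj : injective h.
    apply/linear_injP => x; rewrite hE => -[fx0].
    move/((linear_injP iB).1 iB_inj)/ex => [a aE]; move: fx0.
    by rewrite -aE fE => /((linear_injP iA).1 iA_inj) ->; rewrite linear0.
  have [C [r seC]] := exists_coker h_inj; have [_ r_surj exC] := seC.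
  exists (prod_fgmod PA PB), (FgMod (fin_gen_surj r_surj (fgmodP _))), h, r.
  split=> //; first exact: projective_prod.
  have [|a [b [sab _ _]]] := @coker_short_exact _ _ _ _ _ _ _ _ _ pA r pB
    (short_exact_left PA PB) pA_surj r_surj pB_surj.
  split.
  + move=> x; rewrite exA exC; split=> [[y <-]|[y]].
      by exists (i y); rewrite hE fE (short_exact_comp0 _ se) linear0.
    rewrite hE => -[fy /((linear_injP iB).1 iB_inj)/ex[a aE]].
    by exists a; rewrite -fy -aE fE.
  + by move=> y /exC[x <-]; rewrite hE /= (short_exact_comp0 _ seB).
  + move=> _ /exB[y <-]; have [x <-] := p_surj y.
    by exists (h x); [rewrite hE|apply: short_exact_comp0 seC].
  by exists A', B', a, b.
- have [PA [A' [iA [pA [projA seA XA']]]]] := resX _ XA.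
  have [PB [B' [iB [pB [projB seB XB']]]]] := resX _ XB.
  have [iA_inj pA_surj exA] := seA; have [iB_inj pB_surj exB] := seB.
  have [t tE] := projB _ _ p pB p_surj.
  pose q : {linear prod_fgmod PA PB -> E} :=
    (i \o (pA \o pr_left PA PB)) \+ (t \o pr_right PA PB).
  have [|K [k seK]] := @exists_ker _ _ _ q.
    move=> y; have [z zE] := pB_surj (p y).
    have /ex[x xE] : p (y - t z) = 0 by rewrite linearB /= tE zE subrr.
    have [x' x'E] := pA_surj x.
    by exists (x', z); rewrite /q /= x'E xE subrK.
  have [k_inj q_surj exK] := seK.
  exists (prod_fgmod PA PB), (FgMod (fin_gen_sub noethS k_inj (fgmodP _))).
  exists k, q.
  split=> //; first exact: projective_prod.
  have [|a [b [sab _ _]]] := @ker_short_exact _ _ _ _ _ _ _ _ _ iA k iB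
    (short_exact_left PA PB) iA_inj k_inj iB_inj.
  split.
  + move=> x; rewrite -exA -exK /q /= linear0 addr0.
    by split=> [->|]; rewrite ?linear0 //; apply: (linear_injP i).1.
  + move=> y; apply/exB; rewrite -tE /=.
    have := congr1 p (short_exact_comp0 y seK); rewrite /q linearD linear0 /=.
    by rewrite (short_exact_comp0 _ se) add0r.
  + move=> z; have /ex[x xE] : p (t (iB z)) = 0.
      by rewrite tE (short_exact_comp0 _ seB).
    have [x' x'E] := pA_surj x.
    (* The image of [iB z] under [t] lies in [A], and the first coordinate [- x'] cancels it. *)
    have /exK[y yE] : q (- x', iB z) = 0.
      by rewrite /q /= !linearN /= x'E xE addNr.
    by exists y; rewrite yE.
  by exists A', B', a, b.
Qed.

Record frobenius_base (X : fgmod S -> Prop) : Prop := FrobeniusBase {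
  fb_gorenstein : gorenstein_class X;
  fb_projective : forall P, projective_module P -> X P;
  fb_extension : forall E, extension_of X E -> X E
}.

Lemma projective_gorenstein_class : gorenstein_class (@projective_module S).
Proof.
split=> P projP; first exact: projective_ext1.
  exists P, (zero_fgmod S), idfun, \0; split=> //; last exact: projective_zero.
  split=> // [y|y]; first by exists 0; rewrite [RHS]zero_fgmodE.
  by split=> // _; exists y.
exists P, (zero_fgmod S), \0, idfun; split=> //; last exact: projective_zero.
split=> [x y _|y|y]; first by rewrite [LHS]zero_fgmodE [RHS]zero_fgmodE.
  by exists y.
by split=> [/= ->|[x <-]] //; exists 0.
Qed.

Lemma projective_frobenius_base : frobenius_base (@projective_module S).
Proof.
split=> [|//|E [A [B [i [p [se projA projB]]]]]].
  exact: projective_gorenstein_class.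
exact: projective_ext se projA projB.
Qed.

(** Both closure conditions are instances of maximality: the projectives and the extensions of
    Gorenstein projectives each form a [gorenstein_class]. *)
Lemma gorenstein_frobenius_base : frobenius_base (@gorenstein_projective S).
Proof.
split=> [|P|E]; first exact: gorenstein_projective_class.
  exact: gorenstein_class_sub projective_gorenstein_class.
apply: gorenstein_class_sub; apply: extension_gorenstein_class.
exact: gorenstein_projective_class.
Qed.

End Gorenstein.

(** * Conflations in the morphism category *)

Section Preadditive.

Variable C : preadditive.

Lemma comp_arrBr (X Y Z : C) (g : arr Y Z) (f f' : arr X Y) :
  g \oc (f - f') = g \oc f - g \oc f'.
Proof. by apply: (canRL (addrK _)); rewrite -comp_arrDr subrK. Qed.

Lemma comp_arrBl (X Y Z : C) (g g' : arr Y Z) (f : arr X Y) :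
  (g - g') \oc f = g \oc f - g' \oc f.
Proof. by apply: (canRL (addrK _)); rewrite -comp_arrDl subrK. Qed.

Lemma comp_arrf0 (X Y Z : C) (g : arr Y Z) : g \oc (0 : arr X Y) = 0.
Proof. by rewrite -(subrr 0) comp_arrBr subrr. Qed.

Lemma comp_arr0f (X Y Z : C) (f : arr X Y) : (0 : arr Y Z) \oc f = 0.
Proof. by rewrite -(subrr 0) comp_arrBl subrr. Qed.

(** Working in an arbitrary preadditive category makes this applicable inside the full subcategory,
    once the biproduct and the cokernel are known to lie in it. *)
Lemma pushout_of_cokernel (X Y X' B Y' : C) (i : arr X Y) (f : arr X X')
    (i1 : arr X' B) (i2 : arr Y B) p1 p2 (r : arr B Y') :
  is_biproduct i1 i2 p1 p2 -> is_cokernel (i2 \oc i - i1 \oc f) r ->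
  is_pushout i f (r \oc i1) (r \oc i2).
Proof.
move=> [p1i1 p2i2 p2i1 p1i2 ip] [r0 rU]; split.
  by apply: subr0_eq; rewrite -!comp_arrA -comp_arrBr.
move=> T s t st.
have [|u [ur uU]] := rU T (t \oc p1 + s \oc p2).
  rewrite comp_arrBr !comp_arrDl -!comp_arrA.
  rewrite ![p1 \oc (_ \oc _)]comp_arrA ![p2 \oc (_ \oc _)]comp_arrA.
  rewrite p1i1 p2i1 p1i2 p2i2 !comp_arr1f !comp_arr0f !comp_arrf0.
  by rewrite addr0 add0r st subrr.
exists u; split=> [|v [vs vt]].
  rewrite !comp_arrA ur !comp_arrDl -!comp_arrA p1i1 p2i1 p1i2 p2i2.
  by rewrite !comp_arrf1 !comp_arrf0 addr0 add0r.
apply: uU; rewrite -[LHS]comp_arrf1 -ip comp_arrDr !comp_arrA.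
by rewrite -(comp_arrA v r i1) -(comp_arrA v r i2) vs vt.
Qed.

Lemma pullback_of_kernel (Y Z Y' B Z' : C) (p : arr Y Z) (f : arr Z' Z)
    (i1 : arr Y B) (i2 : arr Z' B) p1 p2 (k : arr Y' B) :
  is_biproduct i1 i2 p1 p2 -> is_kernel k (p \oc p1 - f \oc p2) ->
  is_pullback p f (p2 \oc k) (p1 \oc k).
Proof.
move=> [p1i1 p2i2 p2i1 p1i2 ip] [k0 kU]; split.
  by apply: subr0_eq; rewrite !comp_arrA -comp_arrBl.
move=> T s t st.
have [|u [ku uU]] := kU T (i1 \oc s + i2 \oc t).
  rewrite comp_arrBl !comp_arrDr -!comp_arrA.
  rewrite ![p1 \oc (_ \oc _)]comp_arrA ![p2 \oc (_ \oc _)]comp_arrA.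
  rewrite p1i1 p2i1 p1i2 p2i2 !comp_arr1f !comp_arr0f !comp_arrf0.
  by rewrite addr0 add0r st subrr.
exists u; split=> [|v [vs vt]].
  rewrite -!comp_arrA ku !comp_arrDr !comp_arrA p1i1 p2i1 p1i2 p2i2.
  by rewrite !comp_arr1f !comp_arr0f addr0 add0r.
apply: uU; rewrite -[LHS]comp_arr1f -ip comp_arrDl -!comp_arrA.
by rewrite (comp_arrA p1 k v) (comp_arrA p2 k v) vs vt.
Qed.

Variable E : pair_class C.

Lemma retract_projective (P Q : C) (s : arr P Q) (r : arr Q P) :
  r \oc s = id_arr P -> projective_object E Q -> projective_object E P.
Proof.
move=> rs projQ Y Z p f defp; have [u pu] := projQ Y Z p (f \oc r) defp.
by exists (u \oc s); rewrite comp_arrA pu -comp_arrA rs comp_arrf1.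
Qed.

Lemma retract_injective (P Q : C) (s : arr P Q) (r : arr Q P) :
  r \oc s = id_arr P -> injective_object E Q -> injective_object E P.
Proof.
move=> rs injQ X Y i f infi; have [u ui] := injQ X Y i (s \oc f) infi.
by exists (r \oc u); rewrite -comp_arrA ui comp_arrA rs comp_arr1f.
Qed.

End Preadditive.

Section MorSequences.

Variable S : comNzRingType.
Implicit Types X Y Z T : mor_obj S.

Definition mor_inj X Y (f : mor_hom X Y) :=
  injective (hom1 f) /\ injective (hom0 f).

Definition mor_surj X Y (f : mor_hom X Y) :=
  surjective (hom1 f) /\ surjective (hom0 f).

(** A monomorphism as target forces the source components, so morphisms into objects of [Mon] are
    compared on their second components only. *)
Lemma mor_hom_inj_eq X Y (f g : mor_hom X Y) :
  injective (mor_map Y) -> hom0 f =1 hom0 g -> f = g.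
Proof.
move=> injY fg; apply: mor_hom_eq => // x; apply: injY.
by rewrite -!hom_comm fg.
Qed.

Lemma mor_short_exact_inj X Y Z (f : mor_hom X Y) (g : mor_hom Y Z) :
  mor_short_exact f g -> mor_inj f.
Proof. by move=> [[? _ _] [? _ _]]. Qed.

Lemma mor_short_exact_surj X Y Z (f : mor_hom X Y) (g : mor_hom Y Z) :
  mor_short_exact f g -> mor_surj g.
Proof. by move=> [[_ ? _] [_ ? _]]. Qed.

Lemma mor_factor_surj X Y Z (s : mor_hom X Y) (f : mor_hom X Z) :
  mor_surj s -> (forall x, hom1 s x = 0 -> hom1 f x = 0) ->
  (forall x, hom0 s x = 0 -> hom0 f x = 0) ->
  exists g : mor_hom Y Z, mor_comp g s = f.
Proof.
move=> [s1 s0] k1 k0.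
have [g1 g1E] := factor_surj s1 k1; have [g0 g0E] := factor_surj s0 k0.
have gC x : g0 (mor_map Y x) = mor_map Z (g1 x).
  by have [y <-] := s1 x; rewrite -hom_comm g0E g1E hom_comm.
by exists (MorHom gC); apply: mor_hom_eq.
Qed.

Lemma mor_factor_inj X Y Z (i : mor_hom Y Z) (f : mor_hom X Z) :
  mor_inj i -> (forall x, exists y, hom1 i y = hom1 f x) ->
  (forall x, exists y, hom0 i y = hom0 f x) ->
  exists g : mor_hom X Y, mor_comp i g = f.
Proof.
move=> [i1 i0] k1 k0.
have [g1 g1E] := factor_inj i1 k1; have [g0 g0E] := factor_inj i0 k0.
have gC x : g0 (mor_map X x) = mor_map Y (g1 x).
  by apply: i0; rewrite hom_comm g0E g1E hom_comm.
by exists (MorHom gC); apply: mor_hom_eq.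
Qed.

Lemma mor_coker X Y (f : mor_hom X Y) :
  mor_inj f -> exists Z (g : mor_hom Y Z), mor_short_exact f g.
Proof.
move=> [f1 f0]; have [Z1 [p1 se1]] := exists_coker f1.
have [Z0 [p0 se0]] := exists_coker f0.
have [_ p1_surj ex1] := se1; have [_ p0_surj ex0] := se0.
have [|m mE] := @factor_surj _ _ _ _ p1 (p0 \o mor_map Y) p1_surj.
  by move=> x /ex1[y <-]; apply/ex0; exists (mor_map X y); rewrite hom_comm.
pose Z := @MorObj S (FgMod (fin_gen_surj p1_surj (fgmodP _)))
                    (FgMod (fin_gen_surj p0_surj (fgmodP _))) m.
have pC x : p0 (mor_map Y x) = mor_map Z (p1 x) by rewrite /= mE.
by exists Z, (@MorHom S Y Z p1 p0 pC).
Qed.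

Lemma mor_ker X Y (f : mor_hom X Y) : noetherian_ring S ->
  mor_surj f -> exists Z (g : mor_hom Z X), mor_short_exact g f.
Proof.
move=> noethS [f1 f0]; have [Z1 [i1 se1]] := exists_ker f1.
have [Z0 [i0 se0]] := exists_ker f0.
have [i1_inj _ ex1] := se1; have [i0_inj _ ex0] := se0.
have [|m mE] := @factor_inj _ _ _ _ i0 (mor_map X \o i1) i0_inj.
  move=> x; apply/ex0; rewrite /= hom_comm (short_exact_comp0 _ se1).
  by rewrite linear0.
pose Z := @MorObj S (FgMod (fin_gen_sub noethS i1_inj (fgmodP _)))
                    (FgMod (fin_gen_sub noethS i0_inj (fgmodP _))) m.
have iC x : i0 (mor_map Z x) = mor_map X (i1 x) by rewrite /= mE.
by exists Z, (@MorHom S Z X i1 i0 iC).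
Qed.

Lemma mor_short_exact_kernel X Y Z (f : arr (p := Mor S) X Y)
    (g : arr (p := Mor S) Y Z) :
  mor_short_exact f g -> is_kernel f g.
Proof.
move=> se; have [f1 f0] := mor_short_exact_inj se; have [se1 se0] := se.
split=> [|T t gt0].
  apply: mor_hom_eq => x; first exact: short_exact_comp0 se1.
  exact: short_exact_comp0 se0.
have [//|||u uE] := @mor_factor_inj T X Y f t.
- move=> x; have [_ _ ex] := se1; apply/ex.
  exact: (congr1 (fun h : mor_hom T Z => hom1 h x) gt0).
- move=> x; have [_ _ ex] := se0; apply/ex.
  exact: (congr1 (fun h : mor_hom T Z => hom0 h x) gt0).
exists u; split=> // v; rewrite -uE => uv; apply: mor_hom_eq => x.
  apply: f1; exact: (congr1 (fun h : mor_hom T Y => hom1 h x) (esym uv)).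
apply: f0; exact: (congr1 (fun h : mor_hom T Y => hom0 h x) (esym uv)).
Qed.

Lemma mor_short_exact_cokernel X Y Z (f : arr (p := Mor S) X Y)
    (g : arr (p := Mor S) Y Z) :
  mor_short_exact f g -> is_cokernel f g.
Proof.
move=> se; have [g1 g0] := mor_short_exact_surj se; have [se1 se0] := se.
split=> [|T t tf0].
  apply: mor_hom_eq => x; first exact: short_exact_comp0 se1.
  exact: short_exact_comp0 se0.
have [//|||u uE] := @mor_factor_surj Y Z T g t.
- move=> x; have [_ _ ex] := se1; move=> /ex[y <-].
  exact: (congr1 (fun h : mor_hom X T => hom1 h y) tf0).
- move=> x; have [_ _ ex] := se0; move=> /ex[y <-].
  exact: (congr1 (fun h : mor_hom X T => hom0 h y) tf0).
exists u; split=> // v; rewrite -uE => uv; apply: mor_hom_eq => x.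
  have [y <-] := g1 x.
  exact: (congr1 (fun h : mor_hom Y T => hom1 h y) (esym uv)).
have [y <-] := g0 x.
exact: (congr1 (fun h : mor_hom Y T => hom0 h y) (esym uv)).
Qed.

Lemma short_exact_iso (U V W U' V' W' : lmodType S)
    (f : {linear U -> V}) (g : {linear V -> W})
    (f' : {linear U' -> V'}) (g' : {linear V' -> W'})
    (a : {linear U -> U'}) (b : {linear V -> V'}) (c : {linear W -> W'}) :
  bijective a -> bijective b -> bijective c ->
  (forall x, b (f x) = f' (a x)) -> (forall x, c (g x) = g' (b x)) ->
  short_exact f g -> short_exact f' g'.
Proof.
move=> [a' aK aK'] [b' bK bK'] [c' cK cK'] bf cg [f_inj g_surj ex].
split=> [x y|z|y].
- rewrite -[x]aK' -[y]aK' -!bf => /(can_inj bK)/f_inj-> //.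
- have [y yE] := g_surj (c' z); exists (b y).
  by rewrite -cg yE cK'.
- rewrite -[y]bK' -cg; split=> [cg0|[x]].
    have /ex[x <-] : g (b' y) = 0 by apply: (can_inj cK); rewrite cg0 linear0.
    by exists (a x); rewrite bf.
  rewrite -[x]aK' -bf => /(can_inj bK) xE.
  by rewrite (_ : g _ = 0) ?linear0 //; apply/ex; exists (a' x).
Qed.

Lemma mor_iso_bij X Y (f : arr (p := Mor S) X Y) : is_iso f ->
  bijective (hom1 (f : mor_hom X Y)) /\ bijective (hom0 (f : mor_hom X Y)).
Proof.
move=> [g [gf fg]]; split.
  exists (hom1 (g : mor_hom Y X)) => x.
    exact: (congr1 (fun h : mor_hom X X => hom1 h x) gf).
  exact: (congr1 (fun h : mor_hom Y Y => hom1 h x) fg).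
exists (hom0 (g : mor_hom Y X)) => x.
  exact: (congr1 (fun h : mor_hom X X => hom0 h x) gf).
exact: (congr1 (fun h : mor_hom Y Y => hom0 h x) fg).
Qed.

Lemma mor_short_exact_iso_closed : iso_closed (@mor_short_exact S).
Proof.
move=> X Y Z i p X' Y' Z' i' p' a b c ia ib ic bi cp [se1 se0].
have [a1 a0] := mor_iso_bij ia; have [b1 b0] := mor_iso_bij ib.
have [c1 c0] := mor_iso_bij ic.
split.
  apply: (short_exact_iso a1 b1 c1) se1 => x.
    exact: (congr1 (fun h : mor_hom X Y' => hom1 h x) bi).
  exact: (congr1 (fun h : mor_hom Y Z' => hom1 h x) cp).
apply: (short_exact_iso a0 b0 c0) se0 => x.
  exact: (congr1 (fun h : mor_hom X Y' => hom0 h x) bi).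
exact: (congr1 (fun h : mor_hom Y Z' => hom0 h x) cp).
Qed.

Lemma mor_coker_short_exact X1 Y1 Z1 X2 Y2 Z2
    (f1 : mor_hom X1 Y1) (g1 : mor_hom Y1 Z1)
    (pX : mor_hom X1 X2) (pY : mor_hom Y1 Y2) (pZ : mor_hom Z1 Z2) :
  mor_short_exact f1 g1 -> mor_surj pX -> mor_surj pY -> mor_surj pZ ->
  coker_compatible (hom1 f1) (hom1 g1) (hom1 pX) (hom1 pY) (hom1 pZ) ->
  coker_compatible (hom0 f1) (hom0 g1) (hom0 pX) (hom0 pY) (hom0 pZ) ->
  exists (f2 : mor_hom X2 Y2) (g2 : mor_hom Y2 Z2),
    [/\ mor_short_exact f2 g2, mor_comp f2 pX = mor_comp pY f1
      & mor_comp g2 pY = mor_comp pZ g1].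
Proof.
move=> [se1 se0] [pX1 pX0] [pY1 pY0] [pZ1 pZ0] c1 c0.
have [f21 [g21 [se21 f21E g21E]]] :=
  coker_short_exact se1 pX1 pY1 pZ1 c1.
have [f20 [g20 [se20 f20E g20E]]] :=
  coker_short_exact se0 pX0 pY0 pZ0 c0.
have fC x : f20 (mor_map X2 x) = mor_map Y2 (f21 x).
  by have [y <-] := pX1 x; rewrite -hom_comm f20E f21E !hom_comm.
have gC x : g20 (mor_map Y2 x) = mor_map Z2 (g21 x).
  by have [y <-] := pY1 x; rewrite -hom_comm g20E g21E !hom_comm.
by exists (MorHom fC), (MorHom gC); split=> //; apply: mor_hom_eq.
Qed.

Lemma mor_ker_short_exact X1 Y1 Z1 X2 Y2 Z2
    (f1 : mor_hom X1 Y1) (g1 : mor_hom Y1 Z1)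
    (kX : mor_hom X2 X1) (kY : mor_hom Y2 Y1) (kZ : mor_hom Z2 Z1) :
  mor_short_exact f1 g1 -> mor_inj kX -> mor_inj kY -> mor_inj kZ ->
  ker_compatible (hom1 f1) (hom1 g1) (hom1 kX) (hom1 kY) (hom1 kZ) ->
  ker_compatible (hom0 f1) (hom0 g1) (hom0 kX) (hom0 kY) (hom0 kZ) ->
  exists (f2 : mor_hom X2 Y2) (g2 : mor_hom Y2 Z2),
    [/\ mor_short_exact f2 g2, mor_comp kY f2 = mor_comp f1 kX
      & mor_comp kZ g2 = mor_comp g1 kY].
Proof.
move=> [se1 se0] [kX1 kX0] [kY1 kY0] [kZ1 kZ0] c1 c0.
have [f21 [g21 [se21 f21E g21E]]] := ker_short_exact se1 kX1 kY1 kZ1 c1.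
have [f20 [g20 [se20 f20E g20E]]] := ker_short_exact se0 kX0 kY0 kZ0 c0.
have fC x : f20 (mor_map X2 x) = mor_map Y2 (f21 x).
  by apply: kY0; rewrite f20E !hom_comm f21E.
have gC x : g20 (mor_map Y2 x) = mor_map Z2 (g21 x).
  by apply: kZ0; rewrite g20E !hom_comm g21E.
by exists (MorHom fC), (MorHom gC); split=> //; apply: mor_hom_eq.
Qed.

Section Product.

Variables X Y : mor_obj S.

Lemma mor_prod_linear :
  linear (fun x : mor_src X * mor_src Y => (mor_map X x.1, mor_map Y x.2)).
Proof. by move=> a [x y] [x' y'] /=; rewrite !linearP. Qed.

Definition mor_prod : mor_obj S :=
  @MorObj S (prod_fgmod (mor_src X) (mor_src Y))
    (prod_fgmod (mor_tgt X) (mor_tgt Y)) (mk_linear mor_prod_linear).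

Lemma mor_inl_comm x :
  in_left (mor_tgt X) (mor_tgt Y) (mor_map X x)
  = mor_map mor_prod (in_left _ _ x).
Proof. by congr (_, _); rewrite /= linear0. Qed.

Lemma mor_inr_comm y :
  in_right (mor_tgt X) (mor_tgt Y) (mor_map Y y)
  = mor_map mor_prod (in_right _ _ y).
Proof. by congr (_, _); rewrite /= linear0. Qed.

Definition mor_inl : mor_hom X mor_prod :=
  @MorHom S X mor_prod (in_left _ _) (in_left _ _) mor_inl_comm.
Definition mor_inr : mor_hom Y mor_prod :=
  @MorHom S Y mor_prod (in_right _ _) (in_right _ _) mor_inr_comm.
Definition mor_prl : mor_hom mor_prod X :=
  @MorHom S mor_prod X (pr_left _ _) (pr_left _ _) (fun=> erefl).
Definition mor_prr : mor_hom mor_prod Y :=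
  @MorHom S mor_prod Y (pr_right _ _) (pr_right _ _) (fun=> erefl).

Lemma mor_short_exact_left : mor_short_exact mor_inl mor_prr.
Proof. by split; apply: short_exact_left. Qed.

Lemma mor_biproduct :
  @is_biproduct (Mor S) X Y mor_prod mor_inl mor_inr mor_prl mor_prr.
Proof.
by split; apply: mor_hom_eq => x //; case: x => x y;
  congr (_, _); rewrite /= ?addr0 ?add0r.
Qed.

End Product.

End MorSequences.

(** * Monomorphisms with cokernel killed by w *)

Section Compatible.

Variable S : comNzRingType.
Implicit Types U V W : lmodType S.

(** Input for the third isomorphism theorem: the cokernel of [j \o i] is an extension of that of [j]
    by that of [i]. *)
Lemma comp_coker_compatible U V W V' W' W'' (i : {linear U -> V})
    (p : {linear V -> V'}) (j : {linear V -> W}) (q : {linear W -> W'})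
    (r : {linear W -> W''}) :
  short_exact i p -> short_exact j q -> short_exact (j \o i) r ->
  coker_compatible j q p r (idfun : {linear W' -> W'}).
Proof.
move=> [i_inj _ exi] [j_inj _ exj] [_ _ exr]; split=> [x|y|z /= ->].
- rewrite exi exr; split=> [[y <-]|[y /= /j_inj <-]]; first by exists y.
  by exists y.
- by move=> /exr[x <-]; apply/exj; exists (i x).
- by exists 0; rewrite linear0.
Qed.

(** Dually, the kernel of [q \o p] is an extension of that of [q] by that of [p]. *)
Lemma comp_ker_compatible U V W U' V' U'' (i : {linear U' -> U})
    (p : {linear U -> V}) (j : {linear V' -> V}) (q : {linear V -> W})
    (k : {linear U'' -> U}) :
  short_exact i p -> short_exact j q -> short_exact k (q \o p) ->
  ker_compatible i p (idfun : {linear U' -> U'}) k j.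
Proof.
move=> [i_inj p_surj exi] [j_inj _ exj] [_ _ exk]; split=> [x|y|z].
- rewrite -exk /= (exi _).2 ?linear0; last by exists x.
  by split=> // _; exists x.
- by apply/exj/exk; exists y.
- have [x xE] := p_surj (j z).
  have /exk[y yE] : (q \o p) x = 0 by rewrite /= xE; apply/exj; exists z.
  by exists y; rewrite yE xE.
Qed.

(** Here [V'] is the pushout of [i] and [f] up to sign, and the 3x3 lemma makes it an extension of
    [W] by [U']. *)
Lemma pushout_coker_compatible U V W U' V' (i : {linear U -> V})
    (p : {linear V -> W}) (f : U -> U') (k : {linear U -> (U' * V)%type})
    (r : {linear (U' * V)%type -> V'}) :
  short_exact i p -> short_exact k r -> (forall x, k x = (f x, i x)) ->
  coker_compatible (in_left U' V) (pr_right U' V)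
    (idfun : {linear U' -> U'}) r p.
Proof.
move=> [i_inj _ exi] [_ _ exk] kE; split=> [x|y|z].
- split=> [/= ->|/exk[y]]; first by rewrite linear0.
  move=> yx; have := yx; rewrite kE => -[_ /((linear_injP i).1 i_inj) y0].
  by move: yx; rewrite y0 linear0 => -[].
- by move=> /exk[x <-]; rewrite kE /=; apply/exi; exists x.
- move=> /exi[x <-]; exists (k x); first by rewrite kE.
  by apply/exk; exists x.
Qed.

(** Here [V'] is the pullback of [p] and [f] up to sign, and the 3x3 lemma makes it an extension of
    [W'] by [U]. *)
Lemma pullback_ker_compatible U V W W' V' (i : {linear U -> V})
    (p : {linear V -> W}) (f : W' -> W) (k : {linear V' -> (V * W')%type})
    (q : {linear (V * W')%type -> W}) :
  short_exact i p -> short_exact k q ->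
  (forall x, q x = p x.1 + f x.2) ->
  ker_compatible (in_left V W') (pr_right V W') i k
    (idfun : {linear W' -> W'}).
Proof.
move=> [_ p_surj exi] [_ _ exk] qE; split=> [x|y|z]; last first.
- have [x xE] := p_surj (- f z).
  have /exk[y yE] : q (x, z) = 0 by rewrite qE /= xE addNr.
  by exists y; rewrite yE.
- by exists (k y).2.
have f0 : f 0 = 0 by have := qE 0; rewrite !linear0 add0r => <-.
by rewrite -exi -exk qE /= f0 addr0.
Qed.

Lemma projective_ker (A E B : fgmod S) (i : {linear A -> E})
    (p : {linear E -> B}) :
  short_exact i p -> projective_module E -> projective_module B ->
  projective_module A.
Proof.
move=> [i_inj p_surj ex] projE projB.
have [s sK] := projB E B p idfun p_surj.
have [|r rK] := @factor_inj _ _ _ _ i (idfun \- (s \o p)) i_inj.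
  by move=> y; apply/ex; rewrite /= linearB /= sK subrr.
apply: (@projective_retract _ A E i r) projE => x; apply: i_inj.
have /ex px0 : exists y, i y = i x by exists x.
by rewrite rK /= px0 linear0 subr0.
Qed.

Lemma projective_coker (A E B : fgmod S) (i : {linear A -> E})
    (p : {linear E -> B}) (r : {linear E -> A}) :
  short_exact i p -> (forall x, r (i x) = x) -> projective_module E ->
  projective_module B.
Proof.
move=> [i_inj p_surj ex] rK projE.
have [|s sE] := @factor_surj _ _ _ _ p (idfun \- (i \o r)) p_surj.
  by move=> _ /ex[x <-] /=; rewrite rK subrr.
apply: (@projective_retract _ B E s p) projE => z; have [y <-] := p_surj z.
have /ex pir0 : exists x, i x = i (r y) by exists (r y).
by rewrite sE /= linearB /= pir0 subr0.
Qed.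

(** [h] is multiplication by [w] on [V], factored through [f]; the second identity follows by
    cancelling [f]. *)
Lemma kills_coker_section (w : S) U V (f : {linear U -> V}) :
  injective f -> kills_coker w f ->
  exists h : {linear V -> U},
    (forall y, f (h y) = w *: y) /\ forall x, h (f x) = w *: x.
Proof.
move=> f_inj fw; have [|h hE] := @factor_inj _ _ _ _ f (w \*: idfun) f_inj.
  exact: fw.
exists h; split=> // x; apply: f_inj.
by rewrite hE linearZ.
Qed.

Lemma kills_coker_quot (w : S) (X Y : mor_obj S) (p : mor_hom X Y) :
  surjective (hom0 p) -> kills_coker w (mor_map X) -> kills_coker w (mor_map Y).
Proof.
move=> p_surj wX y; have [x <-] := p_surj y; have [z zE] := wX x.
by exists (hom1 p z); rewrite -hom_comm zE linearZ.
Qed.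

(** A preimage [y] in [Y] of [w] times an element of [X] maps to zero in [Z], whose structure map is
    injective, so [y] already comes from [X]. *)
Lemma kills_coker_sub (w : S) (X Y Z : mor_obj S) (i : mor_hom X Y)
    (p : mor_hom Y Z) :
  mor_short_exact i p -> injective (mor_map Z) -> kills_coker w (mor_map Y) ->
  kills_coker w (mor_map X).
Proof.
move=> [[i1_inj _ ex1] se0] injZ wY x; have [i0_inj _ _] := se0.
have [y yE] := wY (hom0 i x).
have /ex1[z zE] : hom1 p y = 0.
  apply: injZ; rewrite -hom_comm yE linearZ /= (short_exact_comp0 _ se0).
  by rewrite scaler0 linear0.
by exists z; apply: i0_inj; rewrite hom_comm zE yE linearZ.
Qed.

Lemma kills_coker_prod (w : S) (X Y : mor_obj S) :
  kills_coker w (mor_map X) -> kills_coker w (mor_map Y) ->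
  kills_coker w (mor_map (mor_prod X Y)).
Proof.
move=> wX wY [x y]; have [x' x'E] := wX x; have [y' y'E] := wY y.
by exists (x', y'); congr (_, _).
Qed.

End Compatible.

Section StandardObjects.

Variables (S : comNzRingType) (w : S) (P Q : fgmod S).

Lemma std_linear : linear (fun x : P * Q => (x.1, w *: x.2)).
Proof.
move=> a [x y] [x' y'] /=; congr (_, _) => /=.
by rewrite scalerDr !scalerA mulrC.
Qed.

Definition mor_std : mor_obj S :=
  @MorObj S (prod_fgmod P Q) (prod_fgmod P Q) (mk_linear std_linear).

End StandardObjects.

Section Mon.

Variables (S : comNzRingType) (w : S) (X : fgmod S -> Prop).
Hypothesis noethS : noetherian_ring S.
Hypothesis w_reg : GRing.lreg w.
Hypothesis baseX : frobenius_base X.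

Definition Mon (Y : Mor S) : Prop :=
  [/\ injective (mor_map Y), X (mor_src Y), projective_module (mor_tgt Y)
    & kills_coker w (mor_map Y)].

Lemma base_regular M : X M -> forall x : M, w *: x = 0 -> x = 0.
Proof.
move=> XM x wx; have [[_ coresX _] _ _] := baseX.
have [P [M' [i [p [projP [i_inj _ _] _]]]]] := coresX _ XM.
apply: (linear_injP i).1 => //; apply: (projective_regular w_reg projP).
by rewrite -linearZ /= wx linear0.
Qed.

(** The cokernel condition on the middle term is assumed: an extension of cokernels killed by [w] is
    in general only killed by the square of [w]. It is obtained from [kills_coker_quot],
    [kills_coker_sub] or [kills_coker_prod]. *)
Lemma Mon_extension (Y1 Y2 Y3 : mor_obj S) (f : mor_hom Y1 Y2)
    (g : mor_hom Y2 Y3) :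
  mor_short_exact f g -> Mon Y1 -> Mon Y3 -> kills_coker w (mor_map Y2) ->
  Mon Y2.
Proof.
move=> [se1 se0] [inj1 X1 proj1 _] [inj3 X3 proj3 _] wY2.
have [f1_inj _ ex1] := se1; have [f0_inj _ ex0] := se0.
split=> //; last exact: projective_ext se0 proj1 proj3.
  apply/linear_injP => y y0.
  have /ex1[x xE] : hom1 g y = 0.
    by apply: (linear_injP _).1 inj3 _ _; rewrite -hom_comm y0 linear0.
  rewrite -xE (_ : x = 0) ?linear0 //; apply: (linear_injP _).1 inj1 _ _.
  by apply: (linear_injP _).1 f0_inj _ _; rewrite hom_comm xE.
apply: (fb_extension baseX).
by exists (mor_src Y1), (mor_src Y3), (hom1 f), (hom1 g).
Qed.

Lemma Mon_prod Y1 Y2 : Mon Y1 -> Mon Y2 -> Mon (mor_prod Y1 Y2).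
Proof.
move=> M1 M2; apply: (Mon_extension (mor_short_exact_left Y1 Y2)) => //.
by apply: kills_coker_prod; [case: M1|case: M2].
Qed.

Lemma Mon_std P Q : projective_module P -> projective_module Q ->
  Mon (mor_std w P Q).
Proof.
move=> projP projQ; have projPQ := projective_prod projP projQ.
split=> //; last 2 first.
- exact: (fb_projective baseX).
- by move=> [x y]; exists (w *: x, y).
apply/linear_injP => -[x y] /= [-> wy].
by rewrite (projective_regular w_reg projQ wy).
Qed.

Definition zero_mor : mor_obj S :=
  @MorObj S (zero_fgmod S) (zero_fgmod S) idfun.

Lemma Mon_zero : Mon zero_mor.
Proof.
split=> // [||y]; last by exists (w *: y).
- exact/(fb_projective baseX)/projective_zero.
- exact: projective_zero.
Qed.

(** * Quillen's axioms for the category of monomorphisms *)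

Local Notation C := (full_sub Mon).
Local Notation conflation := (restrict_class (@mor_short_exact S) (D := Mon)).

Lemma Mon_additive : is_additive C.
Proof.
split=> [|Y1 Y2].
  exists (exist _ zero_mor Mon_zero); apply: mor_hom_eq => x;
  by rewrite [LHS]zero_fgmodE [RHS]zero_fgmodE.
exists (exist _ _ (Mon_prod (svalP Y1) (svalP Y2))).
exists (mor_inl _ _), (mor_inr _ _), (mor_prl _ _), (mor_prr _ _).
exact: mor_biproduct.
Qed.

Lemma Mon_inflation (Y1 Y2 : C) (f : mor_hom (sval Y1) (sval Y2)) Y3
    (g : mor_hom (sval Y2) Y3) :
  Mon Y3 -> mor_short_exact f g -> @inflation C conflation Y1 Y2 f.
Proof. by move=> M3 se; exists (exist _ Y3 M3), g. Qed.

Lemma Mon_deflation (Y2 Y3 : C) (g : mor_hom (sval Y2) (sval Y3)) Y1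
    (f : mor_hom Y1 (sval Y2)) :
  Mon Y1 -> mor_short_exact f g -> @deflation C conflation Y2 Y3 g.
Proof. by move=> M1 se; exists (exist _ Y1 M1), f. Qed.

Lemma Mon_inflation_id (Y : C) : inflation conflation (id_arr Y).
Proof.
apply: (@Mon_inflation Y Y (mor_id _) _ (0 : mor_hom _ zero_mor)) => //.
  exact: Mon_zero.
by split; split=> // [y|y]; [exists 0; rewrite [RHS]zero_fgmodE|
  split=> // _; exists y|exists 0; rewrite [RHS]zero_fgmodE|
  split=> // _; exists y].
Qed.

Lemma Mon_deflation_id (Y : C) : deflation conflation (id_arr Y).
Proof.
apply: (@Mon_deflation Y Y (mor_id _) _ (0 : mor_hom zero_mor _)) => //.
  exact: Mon_zero.
by split; split=> [x y _|y|y]; [rewrite [LHS]zero_fgmodE [RHS]zero_fgmodE|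
  exists y|split=> [/= ->|[x <-]] //; exists 0|
  rewrite [LHS]zero_fgmodE [RHS]zero_fgmodE|
  exists y|split=> [/= ->|[x <-]] //; exists 0].
Qed.

Lemma mor_inj_id (Y : mor_obj S) : mor_inj (mor_id Y).
Proof. by split. Qed.

Lemma mor_surj_id (Y : mor_obj S) : mor_surj (mor_id Y).
Proof. by split=> y; exists y. Qed.

(** The cokernel of the composite is an extension of [W] by [V], and [w] kills its cokernel because
    it is a quotient of [Y3]. *)
Lemma Mon_inflation_comp (Y1 Y2 Y3 : C) (i : arr Y1 Y2) (j : arr Y2 Y3) :
  inflation conflation i -> inflation conflation j ->
  inflation conflation (j \oc i).
Proof.
move=> [V [p se_i]] [W [q se_j]].
have [i1 i0] := mor_short_exact_inj se_i.
have [j1 j0] := mor_short_exact_inj se_j.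
have [K [r se_r]] : exists K (r : mor_hom (sval Y3) K),
    mor_short_exact (mor_comp j i) r.
  by apply: mor_coker; split; apply: inj_comp.
have r_surj := mor_short_exact_surj se_r.
apply: (Mon_inflation _ se_r).
have [a [b [se_ab _ _]]] := mor_coker_short_exact se_j
  (mor_short_exact_surj se_i) r_surj (mor_surj_id _)
  (comp_coker_compatible se_i.1 se_j.1 se_r.1)
  (comp_coker_compatible se_i.2 se_j.2 se_r.2).
apply: (Mon_extension se_ab (svalP V) (svalP W)).
by apply: (kills_coker_quot r_surj.2); case: (svalP Y3).
Qed.

(** The kernel of the composite is an extension of [L] by [K]; the cokernel condition descends from
    [Y1] because [Y3] is a monomorphism. *)
Lemma Mon_deflation_comp (Y1 Y2 Y3 : C) (p : arr Y1 Y2) (q : arr Y2 Y3) :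
  deflation conflation p -> deflation conflation q ->
  deflation conflation (q \oc p).
Proof.
move=> [K [i se_p]] [L [j se_q]].
have [p1 p0] := mor_short_exact_surj se_p.
have [q1 q0] := mor_short_exact_surj se_q.
have [H [k se_k]] : exists H (k : mor_hom H (sval Y1)),
    mor_short_exact k (mor_comp q p).
  apply: mor_ker => //; split=> z /=.
    by have [y <-] := q1 z; have [x <-] := p1 y; exists x.
  by have [y <-] := q0 z; have [x <-] := p0 y; exists x.
apply: (Mon_deflation _ se_k).
have [a [b [se_ab _ _]]] := mor_ker_short_exact se_p (mor_inj_id _)
  (mor_short_exact_inj se_k) (mor_short_exact_inj se_q)
  (comp_ker_compatible se_p.1 se_q.1 se_k.1)
  (comp_ker_compatible se_p.2 se_q.2 se_k.2).
apply: (Mon_extension se_ab (svalP K) (svalP L)).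
by apply: (kills_coker_sub se_k); [case: (svalP Y3)|case: (svalP Y1)].
Qed.

(** The pushout [K] is the cokernel of [(- f, i)]; it is an extension of [V] by [Y3] and a quotient
    of the biproduct [B]. *)
Lemma Mon_pushout (Y1 Y2 Y3 : C) (i : arr Y1 Y2) (f : arr Y1 Y3) :
  inflation conflation i ->
  exists (Y4 : C) (i' : arr Y3 Y4) (f' : arr Y2 Y4),
    is_pushout i f i' f' /\ inflation conflation i'.
Proof.
move=> [V [p se_i]]; have [i1 i0] := mor_short_exact_inj se_i.
pose B := mor_prod (sval Y3) (sval Y2).
pose k : mor_hom (sval Y1) B :=
  mor_comp (mor_inr _ _) i - mor_comp (mor_inl _ _) f.
have k1E x : hom1 k x = (- hom1 (f : mor_hom _ _) x, hom1 (i : mor_hom _ _) x).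
  by congr (_, _); rewrite /= ?sub0r ?subr0.
have k0E x : hom0 k x = (- hom0 (f : mor_hom _ _) x, hom0 (i : mor_hom _ _) x).
  by congr (_, _); rewrite /= ?sub0r ?subr0.
have [K [r se_r]] : exists K (r : mor_hom B K), mor_short_exact k r.
  apply: mor_coker; split=> x y; rewrite ?k1E ?k0E => -[_]; first exact: i1.
  exact: i0.
have r_surj := mor_short_exact_surj se_r.
have [a [b [se_ab aE _]]] := mor_coker_short_exact (mor_short_exact_left _ _)
  (mor_surj_id _) r_surj (mor_short_exact_surj se_i)
  (pushout_coker_compatible se_i.1 se_r.1 k1E)
  (pushout_coker_compatible se_i.2 se_r.2 k0E).
rewrite mor_compf1 in aE.
have MB : Mon B by apply: Mon_prod; apply: svalP.
have MK : Mon K.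
  apply: (Mon_extension se_ab (svalP Y3) (svalP V)).
  by apply: (kills_coker_quot r_surj.2); case: MB.
exists (exist _ K MK), (mor_comp r (mor_inl _ _)), (mor_comp r (mor_inr _ _)).
split; last first.
  by rewrite -aE; exact: (@Mon_inflation Y3 (exist _ K MK) a _ b (svalP V)).
have [r0 rU] := mor_short_exact_cokernel se_r.
apply: (@pushout_of_cokernel C Y1 Y2 Y3 (exist _ B MB) (exist _ K MK) i f
  (mor_inl _ _) (mor_inr _ _) (mor_prl _ _) (mor_prr _ _) r).
  exact: mor_biproduct.
by split=> // T t; apply: rU.
Qed.

Lemma Mon_pullback (Y2 Y3 Z3 : C) (p : arr Y2 Y3) (f : arr Z3 Y3) :
  deflation conflation p ->
  exists (Z2 : C) (p' : arr Z2 Z3) (f' : arr Z2 Y2),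
    is_pullback p f p' f' /\ deflation conflation p'.
Proof.
move=> [U [i se_p]]; have [p1 p0] := mor_short_exact_surj se_p.
pose B := mor_prod (sval Y2) (sval Z3).
pose q : mor_hom B (sval Y3) :=
  mor_comp p (mor_prl _ _) - mor_comp f (mor_prr _ _).
have [H [k se_k]] : exists H (k : mor_hom H B), mor_short_exact k q.
  apply: mor_ker => //; split=> z.
    have [y yE] := p1 z; exists (y, 0).
    by rewrite -[RHS]yE -[RHS]subr0 -(linear0 (hom1 (f : mor_hom _ _))).
  have [y yE] := p0 z; exists (y, 0).
  by rewrite -[RHS]yE -[RHS]subr0 -(linear0 (hom0 (f : mor_hom _ _))).
(* [pullback_ker_compatible] expects a sum while [q] is a difference, hence the negated components
   of [f]. *)
have [a [b [se_ab _ bE]]] := mor_ker_short_exact (mor_short_exact_left _ _)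
  (mor_short_exact_inj se_p) (mor_short_exact_inj se_k) (mor_inj_id _)
  (@pullback_ker_compatible _ _ _ _ _ _ _ _ (\- hom1 (f : mor_hom _ _))
    _ _ se_p.1 se_k.1 (fun=> erefl))
  (@pullback_ker_compatible _ _ _ _ _ _ _ _ (\- hom0 (f : mor_hom _ _))
    _ _ se_p.2 se_k.2 (fun=> erefl)).
rewrite mor_comp1f in bE.
have MB : Mon B by apply: Mon_prod; apply: svalP.
have MH : Mon H.
  apply: (Mon_extension se_ab (svalP U) (svalP Z3)).
  by apply: (kills_coker_sub se_k); [case: (svalP Y3)|case: MB].
exists (exist _ H MH), (mor_comp (mor_prr _ _) k), (mor_comp (mor_prl _ _) k).
split; last first.
  by rewrite -bE; exact: (@Mon_deflation (exist _ H MH) Z3 b _ a (svalP U)).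
have [k0 kU] := mor_short_exact_kernel se_k.
apply: (@pullback_of_kernel C Y2 Y3 (exist _ H MH) (exist _ B MB) Z3 p f
  (mor_inl _ _) (mor_inr _ _) (mor_prl _ _) (mor_prr _ _) k).
  exact: mor_biproduct.
by split=> // T t; apply: kU.
Qed.

Lemma Mon_exact : exact_category conflation.
Proof.
split.
- exact: Mon_additive.
- move=> Y1 Y2 Y3 i p se.
  have [pi0 iU] := mor_short_exact_kernel se.
  have [_ pU] := mor_short_exact_cokernel se.
  by split; split=> // T t; [apply: iU|apply: pU].
- move=> Y1 Y2 Y3 i p Z1 Z2 Z3 i' p' a b c ia ib ic.
  exact: (@mor_short_exact_iso_closed S _ _ _ i p _ _ _ i' p' a b c ia ib ic).
- exact: Mon_inflation_id.
- exact: Mon_deflation_id.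
- exact: Mon_inflation_comp.
- exact: Mon_deflation_comp.
- exact: Mon_pushout.
- exact: Mon_pullback.
Qed.



(** * Projective and injective objects *)

(** The [P] component extends on targets, where the cokernel is projective, and the [Q] component on
    sources, by vanishing of Ext^1. The structure map of [B] and [h] transport each to the other
    level. *)
Lemma std_injective P Q (projP : projective_module P)
    (projQ : projective_module Q) :
  injective_object conflation (exist _ _ (Mon_std projP projQ) : C).
Proof.
move=> A B i f [Z [p [se1 se0]]].
have [injA _ _ wA] := svalP A; have [injB _ _ wB] := svalP B.
have [_ XZ projZ _] := svalP Z; have [extX _ _] := fb_gorenstein baseX.
have [h [mh hm]] := kills_coker_section injB wB.
pose f1 : {linear mor_src (sval A) -> (P * Q)%type} := hom1 (f : mor_hom _ _).
pose f0 : {linear mor_tgt (sval A) -> (P * Q)%type} := hom0 (f : mor_hom _ _).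
have fC x : f0 (mor_map (sval A) x) = ((f1 x).1, w *: (f1 x).2).
  exact: (hom_comm (f : mor_hom _ _)).
have [a aE] := projective_ext1 projZ se0 projP (pr_left P Q \o f0).
have [b bE] := extX _ XZ _ _ _ _ se1 Q projQ (pr_right P Q \o f1).
pose u1 : {linear mor_src (sval B) -> prod_fgmod P Q} :=
  (in_left P Q \o (a \o mor_map (sval B))) \+ (in_right P Q \o b).
pose u0 : {linear mor_tgt (sval B) -> prod_fgmod P Q} :=
  (in_left P Q \o a) \+ (in_right P Q \o (b \o h)).
have u1E x : u1 x = (a (mor_map (sval B) x), b x).
  by congr (_, _); rewrite /= ?addr0 ?add0r.
have u0E x : u0 x = (a x, b (h x)).
  by congr (_, _); rewrite /= ?addr0 ?add0r.
have uC x : u0 (mor_map (sval B) x) = mor_map (mor_std w P Q) (u1 x).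
  by rewrite u0E u1E hm linearZ.
exists (@MorHom S (sval B) (mor_std w P Q) u1 u0 uC).
have [inj_std _ _ _] := Mon_std projP projQ.
apply: mor_hom_inj_eq => // x; apply: etrans (u0E _) _; rewrite aE.
suff -> : b (h (hom0 (i : mor_hom _ _) x)) = (f0 x).2.
  exact: esym (surjective_pairing (f0 x)).
(* The equality is checked after multiplication by [w]: then [w *: x] comes from [y] in the source
   of [A], where [b] extends the component of [f1]. *)
have [y yE] := wA x.
have -> : h (hom0 (i : mor_hom _ _) x) = hom1 (i : mor_hom _ _) y.
  by apply: injB; rewrite mh -hom_comm yE linearZ.
rewrite bE /=; apply/subr0_eq/(projective_regular w_reg projQ).
rewrite scalerBr; apply/eqP; rewrite subr_eq0; apply/eqP.
have := congr1 snd (fC y); rewrite yE linearZ /= => <-.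
by [].
Qed.

(** The [P] component is lifted on sources and the [Q] component on targets; the structure map of
    [Y] and [h] determine the other levels. *)
Lemma std_projective P Q (projP : projective_module P)
    (projQ : projective_module Q) :
  projective_object conflation (exist _ _ (Mon_std projP projQ) : C).
Proof.
move=> Y Z p f [A [i [[_ p1 _] [_ p0 _]]]].
have [injY _ _ wY] := svalP Y; have [injZ _ _ _] := svalP Z.
have [h [mh hm]] := kills_coker_section injY wY.
pose f1 : {linear (P * Q)%type -> mor_src (sval Z)} := hom1 (f : mor_hom _ _).
pose f0 : {linear (P * Q)%type -> mor_tgt (sval Z)} := hom0 (f : mor_hom _ _).
have fC x : f0 (x.1, w *: x.2) = mor_map (sval Z) (f1 x).
  exact: (hom_comm (f : mor_hom _ _)).
have [a aE] := projP _ _ _ (f1 \o in_left P Q) p1.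
have [b bE] := projQ _ _ _ (f0 \o in_right P Q) p0.
pose u1 : {linear prod_fgmod P Q -> mor_src (sval Y)} :=
  (a \o pr_left P Q) \+ (h \o (b \o pr_right P Q)).
pose u0 : {linear prod_fgmod P Q -> mor_tgt (sval Y)} :=
  (mor_map (sval Y) \o (a \o pr_left P Q)) \+ (b \o pr_right P Q).
have uC x : u0 (mor_map (mor_std w P Q) x) = mor_map (sval Y) (u1 x).
  by rewrite /u0 /u1 /= linearD mh /= linearZ.
exists (@MorHom S (mor_std w P Q) (sval Y) u1 u0 uC).
apply: mor_hom_inj_eq => // -[x y].
apply: etrans
  (_ : hom0 (p : mor_hom _ _) (mor_map (sval Y) (a x) + b y) = _) => //.
rewrite linearD /= hom_comm aE bE -[mor_map _ _]fC /= scaler0 -linearD.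
by congr (f0 (_, _)); rewrite /= ?addr0 ?add0r.
Qed.

(** In the kernel, the source consists of the pairs with [s x + h y = 0], an extension of [Q] by
    [M], and the target is the kernel of a surjection between projectives. *)
Lemma std_cover (Y : C) : exists P Q (projP : projective_module P)
    (projQ : projective_module Q)
    (p : arr (exist _ _ (Mon_std projP projQ) : C) Y),
  deflation conflation p.
Proof.
have [injY XY projY wY] := svalP Y.
have [h [mh hm]] := kills_coker_section injY wY.
have [[_ _ resX] _ _] := baseX.
have [P [M [i [s [projP se_s XM]]]]] := resX _ XY.
have [i_inj s_surj _] := se_s.
set Q := mor_tgt (sval Y).
exists P, Q, projP, projY.
pose p1 : {linear prod_fgmod P Q -> mor_src (sval Y)} :=
  (s \o pr_left P Q) \+ (h \o pr_right P Q).
pose p0 : {linear prod_fgmod P Q -> mor_tgt (sval Y)} :=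
  (mor_map (sval Y) \o (s \o pr_left P Q)) \+ pr_right P Q.
have pC x : p0 (mor_map (mor_std w P Q) x) = mor_map (sval Y) (p1 x).
  by rewrite /p0 /p1 /= linearD mh.
pose p : mor_hom (mor_std w P Q) (sval Y) := MorHom pC.
have p_surj : mor_surj p.
  split=> y; last by exists (0, y); rewrite /= !linear0 add0r.
  by have [x <-] := s_surj y; exists (x, 0); rewrite /= linear0 addr0.
have [K [k se_k]] := mor_ker noethS p_surj.
have [k1_inj _ _] := se_k.1; have [k0_inj _ _] := se_k.2.
have Mstd := Mon_std projP projY.
exists p; apply: (@Mon_deflation (exist _ _ Mstd) Y p K k _ se_k).
have [inj_std _ proj_std w_std] := Mstd.
split.
- by move=> x y xy; apply/k1_inj/inj_std; rewrite -!hom_comm xy.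
- have c := @pullback_ker_compatible _ _ _ _ _ _ _ _ h _ _
    se_s se_k.1 (fun=> erefl).
  have id_inj : injective (idfun : {linear Q -> Q}) by [].
  have [a [b [se_ab _ _]]] := ker_short_exact (short_exact_left P Q)
    i_inj k1_inj id_inj c.
  apply: (fb_extension baseX); exists M, Q, a, b; split=> //.
  exact: (fb_projective baseX).
- exact: projective_ker se_k.2 proj_std projY.
- exact: kills_coker_sub se_k injY w_std.
Qed.

(** In the cokernel, the source is an extension of [M] by [P], and the target is projective because
    [i0] is split by the first projection. Injectivity of the structure map is where regularity of
    [w] on [M] enters. *)
Lemma std_hull (Y : C) : exists P Q (projP : projective_module P)
    (projQ : projective_module Q)
    (i : arr Y (exist _ _ (Mon_std projP projQ) : C)),
  inflation conflation i.
Proof.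
have [injY XY projY wY] := svalP Y.
have [h [mh hm]] := kills_coker_section injY wY.
have [[_ coresX _] _ _] := baseX.
have [Q [M [j [s [projQ se_j XM]]]]] := coresX _ XY.
have [j_inj s_surj exs] := se_j.
set P := mor_tgt (sval Y).
exists P, Q, projY, projQ.
pose i1 : {linear mor_src (sval Y) -> prod_fgmod P Q} :=
  (in_left P Q \o mor_map (sval Y)) \+ (in_right P Q \o j).
pose i0 : {linear mor_tgt (sval Y) -> prod_fgmod P Q} :=
  in_left P Q \+ (in_right P Q \o (j \o h)).
have i1E x : i1 x = (mor_map (sval Y) x, j x).
  by congr (_, _); rewrite /= ?addr0 ?add0r.
have i0E x : i0 x = (x, j (h x)).
  by congr (_, _); rewrite /= ?addr0 ?add0r.
have iC x : i0 (mor_map (sval Y) x) = mor_map (mor_std w P Q) (i1 x).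
  by rewrite i0E i1E /= hm linearZ.
pose i : mor_hom (sval Y) (mor_std w P Q) :=
  @MorHom S (sval Y) (mor_std w P Q) i1 i0 iC.
have i_inj : mor_inj i.
  split=> x y; last by rewrite [X in X = _]i0E [X in _ = X]i0E => -[].
  by rewrite [X in X = _]i1E [X in _ = X]i1E => -[/injY].
have [K [r se_r]] := mor_coker i_inj.
have [r1_surj r0_surj] := mor_short_exact_surj se_r.
have Mstd := Mon_std projY projQ.
exists i; apply: (@Mon_inflation Y (exist _ _ Mstd) i K r _ se_r).
have [_ _ proj_std w_std] := Mstd.
split.
(* If [(x, w *: y)] is [i0 t], then [w] kills [s y], so [y = j g] for some [g]; cancelling [w] again
   shows that [x] is the image of [g], so [(x, y)] is [i1 g]. *)
- apply/linear_injP => z; have [[x y] <-] := r1_surj z.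
  have [_ _ exr0] := se_r.2; have [_ _ exr1] := se_r.1.
  rewrite -hom_comm => /exr0[t]; rewrite i0E => -[tx jht].
  have /exs[g gE] : s y = 0.
    apply: (base_regular XM).
    by rewrite -linearZ /= -jht (short_exact_comp0 _ se_j).
  apply/exr1; exists g; rewrite [LHS]i1E gE; congr (_, _).
  apply/subr0_eq/(projective_regular w_reg projY); rewrite scalerBr.
  have wg : w *: g = h t by apply: j_inj; rewrite linearZ /= gE jht.
  by rewrite -linearZ /= wg mh tx subrr.
- have c := pushout_coker_compatible se_j se_r.1 i1E.
  have id_surj : surjective (idfun : {linear P -> P}) by move=> x; exists x.
  have [a [b [se_ab _ _]]] := coker_short_exact (short_exact_left P Q)
    id_surj r1_surj s_surj c.
  apply: (fb_extension baseX); exists P, M, a, b; split=> //.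
  exact: (fb_projective baseX).
- have rK x : pr_left P Q (hom0 i x) = x by rewrite [X in pr_left _ _ X]i0E.
  exact: projective_coker se_r.2 rK proj_std.
- exact: kills_coker_quot w_std.
Qed.

(** The class [X] does not occur here, which is what allows the comparison of two good classes. *)
Definition std_retract (Y : Mor S) : Prop :=
  exists P Q (s : mor_hom Y (mor_std w P Q)) (r : mor_hom (mor_std w P Q) Y),
    [/\ projective_module P, projective_module Q & mor_comp r s = mor_id Y].

Lemma projective_std_retract (Y : C) :
  projective_object conflation Y -> std_retract (sval Y).
Proof.
move=> projY; have [P [Q [projP [projQ [r defr]]]]] := std_cover Y.
by have [s rs] := projY _ _ r (id_arr Y) defr; exists P, Q, s, r.
Qed.

Lemma injective_std_retract (Y : C) :
  injective_object conflation Y -> std_retract (sval Y).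
Proof.
move=> injY; have [P [Q [projP [projQ [s infs]]]]] := std_hull Y.
by have [r rs] := injY _ _ s (id_arr Y) infs; exists P, Q, s, r.
Qed.

Lemma std_retract_projective (Y : C) :
  std_retract (sval Y) -> projective_object conflation Y.
Proof.
move=> [P [Q [s [r [projP projQ rs]]]]].
apply: (@retract_projective C conflation Y
  (exist _ _ (Mon_std projP projQ)) s r rs).
exact: std_projective.
Qed.

Lemma std_retract_injective (Y : C) :
  std_retract (sval Y) -> injective_object conflation Y.
Proof.
move=> [P [Q [s [r [projP projQ rs]]]]].
apply: (@retract_injective C conflation Y
  (exist _ _ (Mon_std projP projQ)) s r rs).
exact: std_injective.
Qed.

(** Source and target are retracts of projectives, hence projective. This supplies the membership
    part of [projective_in]. *)
Lemma std_retract_Mon Y : std_retract Y -> Mon Y.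
Proof.
move=> [P [Q [s [r [projP projQ rs]]]]].
have rs1 x : hom1 r (hom1 s x) = x.
  exact: (congr1 (fun h : mor_hom Y Y => hom1 h x) rs).
have rs0 x : hom0 r (hom0 s x) = x.
  exact: (congr1 (fun h : mor_hom Y Y => hom0 h x) rs).
have projPQ := projective_prod projP projQ.
have [inj_std _ _ w_std] := Mon_std projP projQ.
split.
- move=> x y xy; apply: (can_inj rs1); apply: inj_std.
  by rewrite -!hom_comm xy.
- exact: (fb_projective baseX) (projective_retract rs1 projPQ).
- exact: projective_retract rs0 projPQ.
- move=> y; have [x xE] := w_std (hom0 s y); exists (hom1 r x).
  by rewrite -hom_comm xE linearZ /= rs0.
Qed.

Lemma Mon_frobenius : frobenius_category conflation.
Proof.
split.
- exact: Mon_exact.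
- move=> Y; have [P [Q [projP [projQ [p defp]]]]] := std_cover Y.
  exists (exist _ _ (Mon_std projP projQ)), p; split=> //.
  exact: std_projective.
- move=> Y; have [P [Q [projP [projQ [i infi]]]]] := std_hull Y.
  exists (exist _ _ (Mon_std projP projQ)), i; split=> //.
  exact: std_injective.
- move=> Y; split=> [/projective_std_retract|/injective_std_retract].
    exact: std_retract_injective.
  exact: std_retract_projective.
Qed.

Lemma projective_in_Mon Y :
  projective_in (@mor_short_exact S) Mon Y <-> std_retract Y.
Proof.
split=> [[MY]|rY]; first exact: (@projective_std_retract (exist _ Y MY)).
exists (std_retract_Mon rY).
exact: (@std_retract_projective (exist _ Y (std_retract_Mon rY))).
Qed.

End Mon.

Theorem corollary2p17 (S : comNzRingType) (n : S -> Prop) (w : S)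
    (noethS : noetherian_ring S) (localS : local_ring n)
    (w_in_n : n w) (w_reg : GRing.lreg w) :
  [/\ frobenius_category (restrict_class (@mor_short_exact S) (D := @MonG S w)),
      frobenius_subcategory (@mor_short_exact S) (@MonP S w) (@MonG S w)
    & forall X : Mor S,
        projective_in (@mor_short_exact S) (@MonP S w) X <->
        projective_in (@mor_short_exact S) (@MonG S w) X].
Proof.
have baseG := gorenstein_frobenius_base noethS.
have baseP := projective_frobenius_base S.
split.
- exact: Mon_frobenius noethS w_reg baseG.
- split; last exact: Mon_frobenius noethS w_reg baseP.
  by move=> X [injX projX ? ?]; split=> //; apply: (fb_projective baseG).
(* Both sides are equivalent to being a [std_retract]. *)
move=> X; apply: (iff_trans (projective_in_Mon noethS w_reg baseP X)).
exact: iff_sym (projective_in_Mon noethS w_reg baseG X).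
Qed.
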